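(* Let $F$ and $F'$ be 4-regular graphs with isomorphic transition matroids. Then some isomorphism $f:M_{\tau}(F)\to M_{\tau}(F')$ has the following properties: (1) There is a bijection $g:V(F)\to V(F')$ compatible with $f$, in the sense that for each $v\in V(F)$ the images under $f$ of the three transitions at $v$ are the three transitions of $F'$ at $g(v)$. (2) If $P$ and $P'$ are circuit partitions of $F$ and $F'$ with $\tau(P')=f(\tau(P))$, then $g$ (viewed as a bijection $E(Tch(P))=V(F)\to V(F')=E(Tch(P'))$) is an isomorphism between the cycle matroids of $Tch(P)$ and $Tch(P')$.
   Context: Graphs may have loops and multiple edges; each edge consists of two half-edges, each incident on one vertex; a 4-regular graph has four half-edges at each vertex. A transition at $v$ is a partition of the four half-edges at $v$ into two pairs; $\mathfrak{T}(F)$ is the set of transitions. A circuit is a closed walk using pairwise distinct half-edges (up to cyclic permutation and reversal). A circuit partition $P$ of $F$ partitions $E(F)$ into circuits; at each vertex its passages determine a transition, and $\tau(P)$ is the set of these transitions. An Euler system is a circuit partition with one circuit per connected component. For an Euler system $C$: $v\neq w$ are interlaced if they appear as $v\dots w\dots v\dots w$ on a circuit of $C$, and $\mathcal{A}$ is the $GF(2)$ adjacency matrix of the interlacement graph on $V(F)$; $\phi_C(v)$ is the transition of $C$ at $v$, $\chi_C(v)$ the other transition pairing entering with leaving half-edges under an orientation of the circuit, $\psi_C(v)$ the third. The transition matroid $M_{\tau}(F)$ is the binary matroid on $\mathfrak{T}(F)$ represented by $(I\mid\mathcal{A}\mid I+\mathcal{A})$ with the columns for $v$ indexed by $\phi_C(v),\chi_C(v),\psi_C(v)$;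 it does not depend on $C$. The touch-graph $Tch(P)$ of a circuit partition $P$ has a vertex for each circuit of $P$ and an edge for each vertex $v$ of $F$; the edge corresponding to $v$ is incident on the vertex or vertices of $Tch(P)$ corresponding to the circuit(s) of $P$ passing through $v$ (a loop if only one circuit passes through $v$). Thus $E(Tch(P))$ is identified with $V(F)$. *)

(* Defs.v *)
From HB Require Import structures.
From mathcomp Require Import all_boot all_order all_algebra.

Set Implicit Arguments.
Unset Strict Implicit.
Unset Printing Implicit Defensive.

Import GRing.Theory.

(* A matroid on a finite ground set is given by its family of independent
   sets; the matroid axioms are not bundled, since only the two concrete
   families below (column matroids and cycle matroids) are used. *)
Definition matroid (E : finType) := {set E} -> Prop.

Definition matroid_iso (E E' : finType) (M : matroid E) (M' : matroid E')
    (f : E -> E') : Prop :=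
  bijective f /\ (forall S : {set E}, M S <-> M' (f @: S)).

(* The matroid represented by [A], the element [e] labelling column [c e]. *)
Definition column_matroid (K : fieldType) (E : finType) (m n : nat)
    (A : 'M[K]_(m, n)) (c : E -> 'I_n) : matroid E :=
  fun S => \rank (colsub (fun i : 'I_#|S| => c (enum_val i)) A) = #|S|.

(* [mg_ends e] is the set of the one (for a loop) or two vertices incident
   with [e]. *)
Record multigraph := Multigraph {
  mg_vertex : finType;
  mg_edge : finType;
  mg_ends : mg_edge -> {set mg_vertex}
}.

(* The cycle v_0 e_0 v_1 e_1 ... v_(k-1) e_(k-1) v_0 is encoded by the sequence
   of the pairs (v_i, e_i): a loop if k = 1, a pair of parallel edges if
   k = 2. *)
Definition mg_cycle (G : multigraph) (p : seq (mg_vertex G * mg_edge G)) : bool :=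
  [&& p != [::], uniq (unzip1 p), uniq (unzip2 p)
    & cycle (fun x y => mg_ends x.2 == [set x.1; y.1]) p].

Definition cycle_matroid (G : multigraph) : matroid (mg_edge G) :=
  fun S => ~ exists2 p : seq (mg_vertex G * mg_edge G),
               mg_cycle p & {subset unzip2 p <= S}.

(* The edges are the pairs {h, mate h}; loops and multiple edges are allowed. *)
Record graph4 := Graph4 {
  vertex : finType;
  half_edge : finType;
  mate : half_edge -> half_edge;
  vtx : half_edge -> vertex;
  mateK : involutive mate;
  mate_neq : forall h, mate h != h;
  graph4_regular : forall v, #|[set h | vtx h == v]| = 4
}.

Section Graph4.

Variable F : graph4.
Implicit Types (v w : vertex F) (h k : half_edge F).

Definition is_transition v (T : {set {set half_edge F}}) : bool :=
  partition T [set h | vtx h == v] && [forall A in T, #|A| == 2].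

(* A transition is stored together with its vertex. *)
Definition transition : finType :=
  {t : vertex F * {set {set half_edge F}} | is_transition t.1 t.2}.

Definition tvertex (t : transition) : vertex F := (val t).1.
Definition tpairs (t : transition) : {set {set half_edge F}} := (val t).2.
Definition transitions_at v : {set transition} := [set t | tvertex t == v].

(* A closed walk is the cyclic sequence of the half-edges along which it leaves
   its successive vertices; its half-edges are those in the sequence and their
   mates.  A [circuit] is thus a circuit with a chosen starting point and
   direction; no notion below that enters the theorem (partition, transitions,
   touch-graph) depends on that choice. *)
Definition is_circuit (s : seq (half_edge F)) : bool :=
  [&& s != [::], uniq (s ++ map (@mate F) s)
    & cycle (fun h k => vtx (mate h) == vtx k) s].

Record circuit := Circuit {
  circuit_seq :> seq (half_edge F);
  circuitP : is_circuit circuit_seq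
}.

Definition circuit_halves (c : circuit) : seq (half_edge F) :=
  c ++ map (@mate F) c.

Definition passes (c : circuit) v : bool := v \in map (@vtx F) c.

Record circuit_partition := CircuitPartition {
  circuits :> seq circuit;
  circuit_partitionP :
    perm_eq (flatten (map circuit_halves circuits)) (enum (half_edge F))
}.

(* At each passage a circuit enters [v] by [mate h] and leaves it by the
   successor of [h]. *)
Definition passages (P : circuit_partition) v : {set {set half_edge F}} :=
  [set A | has (fun c : circuit => [exists h,
     [&& h \in (c : seq _), vtx (mate h) == v & A == [set mate h; next c h]]])
   P].

Definition tau (P : circuit_partition) : {set transition} :=
  [set t | tpairs t == passages P (tvertex t)].

Definition touch_graph (P : circuit_partition) : multigraph :=
  @Multigraph 'I_(size P) (vertex F)
    (fun v => [set i | passes (tnth (in_tuple P) i) v]).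

Definition adjacent : rel (vertex F) :=
  fun v w => [exists h, (vtx h == v) && (vtx (mate h) == w)].

(* Exactly one circuit meets the connected component of each vertex. *)
Definition is_euler (P : circuit_partition) : bool :=
  [forall v, count (fun c : circuit =>
     has (fun h => connect adjacent v (vtx h)) c) P == 1].

Record euler_system := EulerSystem {
  euler_partition :> circuit_partition;
  euler_systemP : is_euler euler_partition
}.

Variable C : euler_system.

Definition interlaced v w : bool :=
  (v != w) &&
  has (fun c : circuit =>
    has (fun i => subseq [:: v; w; v; w] (map (@vtx F) (rot i c)))
      (iota 0 (size c))) C.

Definition interlace_mx : 'M['F_2]_#|vertex F| :=
  (\matrix_(i, j) (interlaced (enum_val i) (enum_val j))%:R)%R.

Definition IAS_mx :
    'M['F_2]_(#|vertex F|, #|vertex F| + (#|vertex F| + #|vertex F|)) :=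
  row_mx 1%:M%R (row_mx interlace_mx (1%:M + interlace_mx)%R).

Definition leaving h : bool := has (fun c : circuit => h \in (c : seq _)) C.
Definition entering h : bool := leaving (mate h).

Definition is_phi (t : transition) : bool := tpairs t == passages C (tvertex t).

Definition is_chi (t : transition) : bool :=
  ~~ is_phi t &&
  [forall A in tpairs t, exists h, exists k,
     [&& entering h, leaving k & A == [set h; k]]].

(* The column of IAS_mx labelled by [t]; the last case is that of psi. *)
Definition transition_col (t : transition) :
    'I_(#|vertex F| + (#|vertex F| + #|vertex F|)) :=
  let v := enum_rank (tvertex t) in
  if is_phi t then lshift _ v
  else if is_chi t then rshift _ (lshift _ v)
  else rshift _ (rshift _ v).

(* The transition matroid of F, as represented by means of C; it is a classical
   fact that it does not depend on C. *)
Definition transition_matroid : matroid transition :=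
  column_matroid IAS_mx transition_col.

End Graph4.

(* Main.v *)
From HB Require Import structures.
Require Import Defs.
From mathcomp Require Import all_boot all_fingroup all_order all_algebra ring zify.

(* In a binary matroid the dependencies are determined by the matroid, so an
   isomorphism carries the space Z of dependencies of M_tau(F) onto that of
   M_tau(F').  Call x : E(F) -> GF(2) a cycle if it is even at every vertex; a
   transition t = {ab|cd} takes on x the value x(a) + x(b) = x(c) + x(d).  The row
   of (I|A|I+A) at w is the family of values on the cycle formed by one of the two
   segments of the Euler circuit between its visits to w, and these segments span
   the cycles modulo functions constant on components.  Hence Z does not involve C:
   it is orthogonal to the values of all cycles; by duality, d lies in Z if and only
   if the family t |-> (sum of d over the transitions other than t at the vertex
   of t) is itself the family of values of a cycle.

   Compatibility: the vertex triples of F and those pulled back from F' are two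
   partitions p, q of the ground set into triples with the same isotropy property.
   While they differ, some automorphism of Z preserves the common triples and creates
   a new one: if a p-triple and a q-triple share exactly two elements, exchange their
   third elements, which are parallel; otherwise the differing triples form 4 x 4
   grids without diagonal, q-triples as rows and p-triples as columns, and a grid can
   be transposed.

   Touch-graphs: a set of transitions of a circuit partition P lies in Z if and only
   if the corresponding edges form a cut of Tch(P), the cycle being a function
   constant on each circuit of P; and cuts determine the cycle matroid. *)

Set Implicit Arguments.
Unset Strict Implicit.
Unset Printing Implicit Defensive.

Import GRing.Theory.
Local Open Scope ring_scope.

(** * Dependencies of column matroids *)

Lemma F2_cases (x : 'F_2) : x = 0 \/ x = 1.
Proof. by case: x => [] [|[|m]] // i; [left|right]; apply: val_inj. Qed.

Lemma F2_neq0 (x : 'F_2) : x != 0 -> x = 1.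
Proof. by case: (F2_cases x) => -> //; rewrite eqxx. Qed.

Lemma F2_addrr (x : 'F_2) : x + x = 0.
Proof. by case: (F2_cases x) => ->; apply: val_inj. Qed.

Lemma F2_eq (x y : 'F_2) : x + y = 0 -> x = y.
Proof. by move=> h; rewrite -[y]add0r -(F2_addrr x) -addrA h addr0. Qed.

Section Dependencies.
Variables (K : fieldType) (E : finType) (m n : nat) (A : 'M[K]_(m, n)).
Variable c : E -> 'I_n.

(** Coefficients are indexed by the ground set and not by the columns, so that elements with equal
    columns stay distinct. *)
Definition dependency (d : {ffun E -> K}) : bool :=
  [forall i, \sum_e d e * A i (c e) == 0].

Definition ssupp (d : {ffun E -> K}) : {set E} := [set e | d e != 0].

Lemma dependencyP (d : {ffun E -> K}) :
  reflect (forall i, \sum_e d e * A i (c e) = 0) (dependency d).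
Proof. exact: 'forall_eqP. Qed.

Lemma column_matroidP (S : {set E}) :
  column_matroid A c S <->
  (forall d, dependency d -> ssupp d \subset S -> d = 0).
Proof.
rewrite /column_matroid; set B := colsub _ _; split.
  move=> rkB d /dependencyP Zd sdS.
  have rfB : row_free B^T by rewrite /row_free mxrank_tr rkB.
  pose v : 'rV[K]_#|S| := \row_i d (enum_val i).
  have : v = 0.
    apply: (row_free_inj rfB); rewrite mul0mx.
    apply/rowP=> i; rewrite !mxE -[RHS](Zd i).
    rewrite [RHS](bigID (mem S)) /= [X in _ = _ + X]big1 ?addr0.
      by rewrite [RHS]big_enum_val; apply: eq_bigr => k _; rewrite !mxE.
    move=> e eS; have /eqP -> : d e == 0; last by rewrite mul0r.
    by apply: contraNT eS => de; apply: (subsetP sdS); rewrite inE.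
  move=> v0; apply/ffunP=> e; rewrite ffunE.
  case: (boolP (e \in S)) => eS.
    by move/rowP/(_ (enum_rank_in eS e)): v0; rewrite !mxE enum_rankK_in.
  by apply/eqP; apply: contraNT eS => de; apply: (subsetP sdS); rewrite inE.
move=> indS; rewrite -mxrank_tr; apply/eqP; apply: inj_row_free => v vB.
(* At most one index contributes to each sum: [d] extends [v] by zero outside [S]. *)
pose d := [ffun e => \sum_(i | enum_val i == e :> E) v 0 (i : 'I_#|S|)].
have dE i : d (enum_val i) = v 0 i.
  by rewrite ffunE (big_pred1 i) // => j; rewrite (inj_eq enum_val_inj).
have d0 e : e \notin S -> d e = 0.
  by move=> eS; rewrite ffunE big1 // => i /eqP ei; rewrite -ei enum_valP in eS.
have : d = 0.
  apply: indS; last first.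
    by apply/subsetP=> e; rewrite inE; apply: contraR => /d0 ->.
  apply/dependencyP=> i; rewrite (bigID (mem S)) /= [X in _ + X]big1 ?addr0.
    move/rowP/(_ i): vB; rewrite !mxE => vBi; rewrite -[RHS]vBi big_enum_val.
    by apply: eq_bigr => k _; rewrite dE !mxE.
  by move=> e /d0 ->; rewrite mul0r.
by move=> dz; apply/rowP=> i; rewrite -dE dz ffunE mxE.
Qed.

Lemma dependencyD (d1 d2 : {ffun E -> K}) : dependency d1 -> dependency d2 -> dependency (d1 +
  d2).
Proof.
move=> /dependencyP h1 /dependencyP h2; apply/dependencyP => i.
under eq_bigr do rewrite ffunE mulrDl.
by rewrite big_split /= h1 h2 addr0.
Qed.

Lemma ssupp_eq0 (d : {ffun E -> K}) : (ssupp d == set0) = (d == 0).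
Proof.
apply/eqP/eqP => [/setP h|->]; last by apply/setP=> e; rewrite !inE ffunE eqxx.
by apply/ffunP=> e; have:= h e; rewrite !inE ffunE => /negbFE/eqP.
Qed.

End Dependencies.

Lemma F2_ssupp_inj (E : finType) : injective (@ssupp 'F_2 E).
Proof.
move=> d1 d2 /setP h; apply/ffunP=> e; have := h e; rewrite !inE.
by case: (F2_cases (d1 e)) => ->; case: (F2_cases (d2 e)) => ->.
Qed.

Lemma column_matroidPn (E : finType) (m n : nat) (A : 'M['F_2]_(m, n)) (c : E -> 'I_n)
    (S : {set E}) : ~ column_matroid A c S ->
  exists d, [/\ dependency A c d, ssupp d \subset S & d != 0].
Proof.
move=> nS; case: (boolP [exists d : {ffun E -> 'F_2},
    [&& dependency A c d, ssupp d \subset S & d != 0]]).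
  by case/existsP=> d /and3P[]; exists d.
rewrite negb_exists => /forallP h; case: nS; apply/column_matroidP => d Zd sd.
by apply/eqP; apply: contraTT (h d) => d0; rewrite Zd sd d0.
Qed.

Section BinaryIso.
Variables (E E' : finType) (m n m' n' : nat).
Variables (A : 'M['F_2]_(m, n)) (A' : 'M['F_2]_(m', n')).
Variables (c : E -> 'I_n) (c' : E' -> 'I_n') (f : E -> E').
Hypothesis f_iso : matroid_iso (column_matroid A c) (column_matroid A' c') f.

Let f_inj : injective f. Proof. by case: f_iso => /bij_inj. Qed.

Lemma imset_ssupp (d : {ffun E' -> 'F_2}) :
  f @: ssupp [ffun e => d (f e)] = ssupp d.
Proof.
case: f_iso => -[g fK gK] _; apply/setP=> e; apply/imsetP/idP.
  by case=> x; rewrite !inE ffunE => h ->.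
by move=> h; exists (g e); rewrite ?inE ?ffunE gK // inE in h *.
Qed.

(* Over F_2 the dependencies are the sums of circuits, and a circuit is a
   minimal nonempty dependent set, which the matroid alone determines. *)
Lemma iso_dependency_pull (d : {ffun E' -> 'F_2}) :
  dependency A' c' d -> dependency A c [ffun e => d (f e)].
Proof.
have [k] := ubnP #|ssupp d|; elim: k d => // k IHk d; rewrite ltnS => dk Zd.
have [->|d0] := eqVneq d 0.
  by apply/dependencyP=> i; rewrite big1 // => e _; rewrite !ffunE mul0r.
pose Q d1 := [&& dependency A' c' d1, ssupp d1 \subset ssupp d & d1 != 0].
have Qd : Q d by rewrite /Q Zd subxx.
case: (arg_minnP (fun d1 => #|ssupp d1|) Qd) => d1 /and3P[Zd1 sd1 d10] mind1.
have Zfd1 : dependency A c [ffun e => d1 (f e)].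
  pose T := ssupp [ffun e => d1 (f e)].
  have fT : f @: T = ssupp d1 by exact: imset_ssupp.
  have nM : ~ column_matroid A c T.
    move=> /f_iso.2; rewrite fT => /column_matroidP h.
    by move: d10; rewrite (h d1) ?eqxx.
  case: (column_matroidPn nM) => d2 [Zd2 sd2 d20].
  suff eT : ssupp d2 = T by rewrite -(F2_ssupp_inj eT).
  (* A smaller [d2] would make the image of its support dependent, hence give a nonzero dependency
     [d3] that contradicts the minimality of [d1]. *)
  apply/eqP; rewrite eqEcard sd2 /= leqNgt; apply/negP=> lt_d2.
  have nM2 : ~ column_matroid A' c' (f @: ssupp d2).
    move=> /f_iso.2 /column_matroidP h.
    by move: d20; rewrite (h d2) ?eqxx.
  case: (column_matroidPn nM2) => d3 [Zd3 sd3 d30].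
  have Q3 : Q d3.
    rewrite /Q Zd3 d30 andbT /=; apply: subset_trans sd3 _.
    by apply: subset_trans sd1; rewrite -fT imsetS.
  have := mind1 d3 Q3; rewrite leqNgt => /negP; apply.
  apply: leq_ltn_trans (subset_leq_card sd3) _.
  by rewrite -fT !card_imset.
(* Adding [d1] deletes its nonempty support from that of [d], so the induction hypothesis applies to
   the sum. *)
have Zs : dependency A c [ffun e => (d + d1) (f e)].
  apply: IHk; last exact: dependencyD.
  apply: leq_trans dk; apply: proper_card; apply/properP; split.
    apply/subsetP=> e; have := subsetP sd1 e; rewrite !inE ffunE.
    by case: (F2_cases (d e)) => -> //; case: (F2_cases (d1 e)) => -> // /(_ isT).
  have /set0Pn[e ed1] : ssupp d1 != set0 by rewrite ssupp_eq0.
  exists e; first exact: (subsetP sd1).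
  have := subsetP sd1 e ed1; rewrite !inE ffunE in ed1 * => ed.
  by rewrite (F2_neq0 ed) (F2_neq0 ed1).
have -> : [ffun e => d (f e)] = [ffun e => (d + d1) (f e)] + [ffun e => d1 (f e)].
  by apply/ffunP=> e; rewrite !ffunE -addrA F2_addrr addr0.
exact: dependencyD.
Qed.

End BinaryIso.

Lemma matroid_iso_inv (E E' : finType) (M : matroid E) (M' : matroid E') f g :
  cancel f g -> cancel g f -> matroid_iso M M' f -> matroid_iso M' M g.
Proof.
move=> fK gK [_ h]; split; first by exists f.
move=> S; have fgS : f @: (g @: S) = S.
  by rewrite -imset_comp (eq_imset (g := id)) ?imset_id // => x /=; rewrite gK.
by have := h (g @: S); rewrite fgS => -[].
Qed.

Lemma iso_dependency (E E' : finType) (m n m' n' : nat)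
    (A : 'M['F_2]_(m, n)) (A' : 'M['F_2]_(m', n'))
    (c : E -> 'I_n) (c' : E' -> 'I_n') (f : E -> E') :
  matroid_iso (column_matroid A c) (column_matroid A' c') f ->
  forall d : {ffun E' -> 'F_2},
    dependency A c [ffun e => d (f e)] = dependency A' c' d.
Proof.
move=> f_iso d; apply/idP/idP; last exact: iso_dependency_pull f_iso d.
case: (f_iso) => -[g fK gK] _ /(iso_dependency_pull (matroid_iso_inv fK gK f_iso)).
by rewrite (_ : finfun _ = d) //; apply/ffunP=> e; rewrite !ffunE gK.
Qed.

(** Independence only speaks of the dependencies supported in a set, so a bijection respecting
    dependencies respects the matroids. This turns automorphisms of the space of dependencies into
    matroid automorphisms. *)
Lemma dependency_iso (K : fieldType) (E E' : finType) (m n m' n' : nat)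
    (A : 'M[K]_(m, n)) (A' : 'M[K]_(m', n'))
    (c : E -> 'I_n) (c' : E' -> 'I_n') (f : E -> E') : bijective f ->
  (forall d : {ffun E' -> K},
    dependency A c [ffun e => d (f e)] = dependency A' c' d) ->
  matroid_iso (column_matroid A c) (column_matroid A' c') f.
Proof.
move=> bf h; split=> // S; case: (bf) => g fK gK.
have [f_inj g_inj] := (can_inj fK, can_inj gK).
split=> /column_matroidP indS; apply/column_matroidP => d Zd sd.
  have : [ffun e => d (f e)] = 0.
    apply: indS; rewrite ?h //; apply/subsetP=> e; rewrite inE ffunE => de.
    by rewrite -(mem_imset _ _ f_inj) (subsetP sd) // inE.
  by move=> d0; apply/ffunP=> e; move/ffunP/(_ (g e)): d0; rewrite !ffunE gK.
pose d' := [ffun e => d (g e)].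
have dE : [ffun e => d' (f e)] = d by apply/ffunP=> e; rewrite !ffunE fK.
have : d' = 0.
  apply: indS; rewrite -?h ?dE //; apply/subsetP=> e; rewrite inE ffunE => de.
  by rewrite -[e]gK mem_imset // (subsetP sd) // inE.
by move=> d0; rewrite -dE d0; apply/ffunP=> e; rewrite !ffunE.
Qed.

(** * Aligning two partitions into triples *)

Section Triple.
Variable T : eqType.
Implicit Types (x y z : T) (s : seq T).

Lemma seq3_first s x : size s = 3%N -> uniq s -> x \in s ->
  exists y z, uniq [:: x; y; z] /\ s =i [:: x; y; z].
Proof.
move=> s3 us /rot_to[i s' def_s].
have := size_rot i s; have := rot_uniq i s; have := mem_rot i s.
rewrite def_s s3 us; case: s' {def_s} => [|y [|z []]] //= ms us' _.
by exists y, z; split=> [|t]; rewrite ?us' // -ms.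
Qed.

Lemma seq3_second s x y : size s = 3%N -> uniq s -> x \in s -> y \in s -> x != y ->
  exists z, uniq [:: x; y; z] /\ s =i [:: x; y; z].
Proof.
move=> s3 us xs ys xy; have [a [b [u ms]]] := seq3_first s3 us xs.
move: ys; rewrite ms !inE eq_sym (negbTE xy) /= => /orP[]/eqP->; first by exists b.
exists a; split=> [|t]; last by rewrite ms !inE [(t == a) || _]orbC.
by move: u; rewrite /= !inE !negb_or eq_sym => /andP[/andP[-> ->]]; rewrite eq_sym.
Qed.

End Triple.

(* In a 3-regular incidence where two blocks, and dually two points, always have
   evenly many common incidences, every flag lies in a 4 x 4 grid minus its diagonal. *)
Lemma incidence_grid (V V' : eqType) (inc : V' -> V -> bool) (r0 : V') (c0 : V) :
  (forall r c, inc r c -> exists s, [/\ size s = 3%N, uniq s & inc^~ c =1 mem s]) ->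
  (forall r c, inc r c -> exists s, [/\ size s = 3%N, uniq s & inc r =1 mem s]) ->
  (forall x y z c c', uniq [:: x; y; z] -> inc^~ c =1 mem [:: x; y; z] ->
     c != c' -> inc x c' (+) inc y c' (+) inc z c' = false) ->
  (forall x y z r r', uniq [:: x; y; z] -> inc r =1 mem [:: x; y; z] ->
     r != r' -> inc r' x (+) inc r' y (+) inc r' z = false) ->
  inc r0 c0 ->
  exists (R : 'I_4 -> V') (C : 'I_4 -> V), [/\ injective R, injective C &
    forall i j, i != j -> inc (R i) (C j)].
Proof.
move=> colP rowP colE rowE inc0.
have col1 r c : inc r c -> exists a b, uniq [:: r; a; b] /\ inc^~ c =1 mem [:: r; a; b].
  move=> h; have [s [s3 us sE]] := colP _ _ h.
  have rs : r \in s by rewrite -[_ \in _]sE.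
  by have [a [b [u ms]]] := seq3_first s3 us rs; exists a, b; split=> // t; rewrite sE /= ms.
have row1 r c : inc r c -> exists a b, uniq [:: c; a; b] /\ inc r =1 mem [:: c; a; b].
  move=> h; have [s [s3 us sE]] := rowP _ _ h.
  have rs : c \in s by rewrite -[_ \in _]sE.
  by have [a [b [u ms]]] := seq3_first s3 us rs; exists a, b; split=> // t; rewrite sE /= ms.
have col2 r r' c : inc r c -> inc r' c -> r != r' ->
    exists a, uniq [:: r; r'; a] /\ inc^~ c =1 mem [:: r; r'; a].
  move=> h h' rr; have [s [s3 us sE]] := colP _ _ h.
  have rs : r \in s by rewrite -[_ \in _]sE.
  have rs' : r' \in s by rewrite -[_ \in _]sE.
  by have [a [u ms]] := seq3_second s3 us rs rs' rr; exists a; split=> // t; rewrite sE /= ms.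
have row2 r c c' : inc r c -> inc r c' -> c != c' ->
    exists a, uniq [:: c; c'; a] /\ inc r =1 mem [:: c; c'; a].
  move=> h h' cc; have [s [s3 us sE]] := rowP _ _ h.
  have rs : c \in s by rewrite -[_ \in _]sE.
  have rs' : c' \in s by rewrite -[_ \in _]sE.
  by have [a [u ms]] := seq3_second s3 us rs rs' cc; exists a; split=> // t; rewrite sE /= ms.
have {row1} [X [Y [uXY rowr0]]] := row1 _ _ inc0.
have {col1} [a0 [b0 [uab0 colc0]]] := col1 _ _ inc0.
(* Since [r0] meets the columns [X] and [Y], exactly one of [a0], [b0] meets each of them; the
   parity of row [a0] rules out the same choice for both. *)
have [a [b [uab cola iaX ibX [ibY iaY]]]] : exists a b,
    [/\ uniq [:: r0; a; b], inc^~ c0 =1 mem [:: r0; a; b], inc a X, inc b X = false & inc b Y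
      /\ inc a Y = false].
  have eX := colE _ _ _ _ X uab0 colc0; have eY := colE _ _ _ _ Y uab0 colc0.
  have ea := rowE _ _ _ _ a0 uXY rowr0.
  have i0X : inc r0 X by rewrite rowr0 /= !inE eqxx orbT.
  have i0Y : inc r0 Y by rewrite rowr0 /= !inE eqxx !orbT.
  have ia0 : inc a0 c0 by rewrite [inc _ _]colc0 /= !inE eqxx orbT.
  have nX : c0 != X by move: uXY; rewrite /= !inE !negb_or => /andP[/andP[]].
  have nY : c0 != Y by move: uXY; rewrite /= !inE !negb_or => /andP[/andP[]].
  have na : r0 != a0 by move: uab0; rewrite /= !inE !negb_or => /andP[/andP[]].
  move: (eX nX) (eY nY) (ea na); rewrite i0X i0Y ia0.
  case iaX: (inc a0 X); case ibX: (inc b0 X) => //= _;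
  case iaY: (inc a0 Y); case ibY: (inc b0 Y) => //= _ _.
    by exists a0, b0.
  exists b0, a0; split=> // [|t].
    by move: uab0; rewrite /= !inE !negb_or eq_sym => /andP[/andP[-> ->]]; rewrite eq_sym.
  by rewrite [LHS]colc0 /= !inE [(t == a0) || _]orbC.
clear a0 b0 uab0 colc0.
have r0b : r0 != b by move: uab; rewrite /= !inE !negb_or => /andP[/andP[]].
have r0a : r0 != a by move: uab; rewrite /= !inE !negb_or => /andP[/andP[]].
have ab : a != b by move: uab; rewrite /= !inE !negb_or => /andP[_ /andP[]].
have c0X : c0 != X by move: uXY; rewrite /= !inE !negb_or => /andP[/andP[]].
have c0Y : c0 != Y by move: uXY; rewrite /= !inE !negb_or => /andP[/andP[]].
have XY : X != Y by move: uXY; rewrite /= !inE !negb_or => /andP[_ /andP[]].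
have i0X : inc r0 X by rewrite rowr0 /= !inE eqxx orbT.
have i0Y : inc r0 Y by rewrite rowr0 /= !inE eqxx !orbT.
have ia0 : inc a c0 by rewrite [inc _ _]cola /= !inE eqxx orbT.
have ib0 : inc b c0 by rewrite [inc _ _]cola /= !inE eqxx !orbT.
(* The third point of row [b] is the fourth column of the grid; further down, the third block of
   column [X] is its fourth row [r1]. *)
have [Z [uZ rowb]] := row2 _ _ _ ib0 ibY c0Y.
have [c0Z YZ] : c0 != Z /\ Y != Z.
  by move: uZ; rewrite /= !inE !negb_or => /andP[/andP[_ ->] /andP[->]].
have ibZ : inc b Z by rewrite rowb /= !inE eqxx !orbT.
have XZ : X != Z by apply: contraFneq ibX => ->.
have i0Z : inc r0 Z = false.
  by rewrite rowr0 /= !inE !(eq_sym Z) (negbTE c0Z) (negbTE XZ) (negbTE YZ).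
have iaZ : inc a Z.
  by move: (colE _ _ _ _ Z uab cola c0Z); rewrite i0Z ibZ; case: (inc a Z).
have [r1 [ur1 colX]] := col2 _ _ _ i0X iaX r0a.
have [r01 ar1] : r0 != r1 /\ a != r1.
  by move: ur1; rewrite /= !inE !negb_or => /andP[/andP[_ ->] /andP[->]].
have i1X : inc r1 X by rewrite [inc _ _]colX /= !inE eqxx !orbT.
have br1 : b != r1 by apply: contraFneq ibX => ->.
have i1Y : inc r1 Y.
  by move: (colE _ _ _ _ Y ur1 colX XY); rewrite i0Y iaY; case: (inc r1 Y).
have i1Z : inc r1 Z.
  by move: (colE _ _ _ _ Z ur1 colX XZ); rewrite i0Z iaZ; case: (inc r1 Z).
(* The two lists are ordered so that the pairs [(r1, c0)], [(r0, Z)], [(b, X)], [(a, Y)] form the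
   diagonal. *)
pose R (i : 'I_4) := nth r1 [:: r1; r0; b; a] i.
pose C (i : 'I_4) := nth c0 [:: c0; Z; X; Y] i.
exists R, C; split.
- move=> i j /eqP; rewrite /R nth_uniq //= => [/eqP/val_inj //|].
  by rewrite !inE !negb_or ![r1 == _]eq_sym [b == a]eq_sym r01 br1 ar1 r0b r0a ab.
- move=> i j /eqP; rewrite /C nth_uniq //= => [/eqP/val_inj //|].
  by rewrite !inE !negb_or ![Z == _]eq_sym c0Z c0X c0Y XZ YZ XY.
by do 2![case=> -[|[|[|[|?]]]] // ?].
Qed.

Lemma set3_ext (T : finType) (S : {set T}) a b : #|S| = 3%N -> a \in S -> b \in S ->
  a != b -> exists c, [/\ c != a, c != b & S = [set a; b; c]].
Proof.
move=> S3 aS bS ab.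
have sS : size (enum S) = 3%N by rewrite -cardE.
have aS' : a \in enum S by rewrite mem_enum.
have bS' : b \in enum S by rewrite mem_enum.
have [c [u mS]] := seq3_second sS (enum_uniq _) aS' bS' ab; exists c; move: u; rewrite /= !inE
  !negb_or => /andP[/andP[_ ac] /andP[bc _]].
rewrite ![c == _]eq_sym; split=> //.
by apply/setP=> t; rewrite -mem_enum mS !inE orbA.
Qed.

Definition fibre (E : finType) (V : eqType) (p : E -> V) (e : E) : {set E} :=
  [set e' | p e' == p e].

Definition indic (E : finType) (S : {set E}) : {ffun E -> 'F_2} :=
  [ffun e => (e \in S)%:R].

(** * Isotropic families of triples and their incidence *)

Section Triples.
Variables (E : finType) (Z : {ffun E -> 'F_2} -> bool).
Hypothesis ZD : forall d1 d2, Z d1 -> Z d2 -> Z (d1 + d2).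

(** On each triple the form of [triples_pairing] is the alternating form over [F_2] whose radical is
    spanned by the indicator of the triple; [Z] is required to be totally isotropic for the sum of
    these forms. *)
Record triples (V : eqType) (p : E -> V) : Prop := Triples {
  triples_card : forall e, #|fibre p e| = 3%N;
  triples_indic : forall e, Z (indic (fibre p e));
  triples_pairing : forall d1 d2 : {ffun E -> 'F_2}, Z d1 -> Z d2 ->
    \sum_e \sum_(e' | (p e' == p e) && (e' != e)) d1 e * d2 e' = 0
}.

Definition Zauto (s : {perm E}) := forall d : {ffun E -> 'F_2}, Z [ffun e => d (s e)] = Z d.

Lemma Zauto_involution (s : {perm E}) : involutive s ->
  (forall d : {ffun E -> 'F_2}, Z d -> Z [ffun e => d (s e)]) -> Zauto s.
Proof.
move=> sK h d; apply/idP/idP => [/h|]; last exact: h.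
by congr Z; apply/ffunP=> e; rewrite !ffunE sK.
Qed.

Lemma fibre_eq (V : eqType) (p : E -> V) e e' : p e = p e' -> fibre p e = fibre p e'.
Proof. by move=> h; apply/setP=> x; rewrite !inE h. Qed.

Definition good (V V' : eqType) (p : E -> V) (q : E -> V') e := fibre p e == fibre q e.

Section Incidence.
Variables (V V' : eqType) (p : E -> V) (q : E -> V').

Lemma good_mem e e' : good p q e -> (p e' == p e) = (q e' == q e).
Proof. by move=> /eqP/setP/(_ e'); rewrite !inE. Qed.

Lemma good_eq e e' : p e = p e' -> good p q e -> good p q e'.
Proof.
move=> pe ge; have /eqP qe : q e' == q e by rewrite -good_mem // pe.
by rewrite /good -(fibre_eq pe) (eqP ge) (fibre_eq qe).
Qed.
End Incidence.

Lemma goodC (V V' : eqType) (p : E -> V) (q : E -> V') e : good p q e = good q p e.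
Proof. exact: eq_sym. Qed.

Section Transversal.
Variables (V V' : eqType) (p : E -> V) (q : E -> V').
Hypotheses (tp : triples p) (tq : triples q).
Hypothesis transversal : forall a b,
  p a = p b -> q a = q b -> ~~ good p q a -> a = b.

(** Triples of [q] are rows and triples of [p] are columns. By transversality an incidence comes
    from a single bad element. *)
Definition bad_inc (r : V') (c : V) : bool :=
  [exists g, [&& q g == r, p g == c & ~~ good p q g]].

Lemma bad_col r c : bad_inc r c -> exists g,
  [/\ p g = c, ~~ good p q g, uniq (map q (enum (fibre p g))) &
      bad_inc^~ c =1 mem (map q (enum (fibre p g)))].
Proof.
case/existsP=> g /and3P[_ /eqP pg bg]; exists g; split=> // [|t].
  rewrite map_inj_in_uniq ?enum_uniq // => x y.
  rewrite !mem_enum !inE => /eqP px /eqP py qxy; apply: transversal => //.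
    by rewrite px py.
  by apply: contraNN bg; apply: good_eq.
apply/existsP/mapP => [[h /and3P[/eqP<- /eqP ph bh]]|[h]].
  by exists h; rewrite // mem_enum inE ph pg.
rewrite mem_enum inE => /eqP ph ->; exists h; rewrite ph pg !eqxx /=.
by apply: contraNN bg; apply: good_eq.
Qed.

Lemma bad_inc_size r c : bad_inc r c ->
  exists s, [/\ size s = 3%N, uniq s & bad_inc^~ c =1 mem s].
Proof.
move=> /bad_col[g [_ _ u m]]; exists (map q (enum (fibre p g))); split=> //.
by rewrite size_map -cardE (triples_card tp).
Qed.

(** This is the isotropy for [q] applied to the indicators of the [p]-triples over [c] and [c']. An
    element of the first triple shares its [q]-triple with at most one element of the second, and
    with one exactly when its row meets [c']. *)
Lemma bad_inc_even x y z c c' : uniq [:: x; y; z] ->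
  bad_inc^~ c =1 mem [:: x; y; z] -> c != c' ->
  bad_inc x c' (+) bad_inc y c' (+) bad_inc z c' = false.
Proof.
move=> u3 m3 cc'.
have [g [pg bg uT mT]] : exists g,
  [/\ p g = c, ~~ good p q g, uniq (map q (enum (fibre p g))) &
      bad_inc^~ c =1 mem (map q (enum (fibre p g)))].
  by apply: (@bad_col x); rewrite [bad_inc _ _]m3 /= inE eqxx.
have pT : perm_eq (map q (enum (fibre p g))) [:: x; y; z].
  by apply: uniq_perm => // t; have := mT t; rewrite m3.
have [[r /existsP[f /and3P[/eqP qf /eqP pf bf]]]|no] : (exists r, bad_inc r c') \/ (forall r,
  ~~ bad_inc r c').
- case: (boolP [exists f, (p f == c') && ~~ good p q f]) => [/existsP[f /andP[h1 h2]]|].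
    by left; exists (q f); apply/existsP; exists f; rewrite eqxx h1 h2.
  rewrite negb_exists => /forallP h; right=> r; rewrite negb_exists; apply/forallP=> f.
  by apply: contra (h f) => /and3P[_ -> ->].
- have := triples_pairing tq (triples_indic tp g) (triples_indic tp f).
  rewrite (eq_bigr (fun e => (indic (fibre p g)) e * (bad_inc (q e) c')%:R)); last first.
    move=> e _; rewrite -mulr_sumr !ffunE; case: (boolP (e \in _)); last by rewrite !mul0r.
    rewrite inE => /eqP pe; congr (_ * _).
    case: (boolP (bad_inc _ _)) => [/existsP[h /and3P[qh /eqP ph bh]]|nh].
      rewrite (bigD1 h) /= ?qh; last first.
        by rewrite eq_sym; apply: contraNneq cc' => he; rewrite -pg -pe he ph.
      rewrite ffunE inE ph pf eqxx big1 ?addr0 // => k /andP[/andP[/eqP qk _] kh].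
      rewrite ffunE inE; case: eqP => // pk; case/eqP: kh; apply/esym/transversal => //.
        by rewrite ph pk.
      by rewrite qk (eqP qh).
    rewrite big1 // => k /andP[qk _]; rewrite ffunE inE; case: eqP => // pk.
    case/existsP: nh; exists k; rewrite qk pk pf eqxx /=.
    by apply: contraNN bf; apply: good_eq.
  rewrite (bigID (mem (fibre p g))) /= [X in _ + X]big1 ?addr0; last first.
    by move=> e /negbTE eT; rewrite ffunE eT mul0r.
  rewrite (eq_bigr (fun e => (bad_inc (q e) c')%:R)); last first.
    by move=> e eT; rewrite ffunE eT mul1r.
  rewrite -big_enum -(big_map q xpredT (fun r => (bad_inc r c')%:R)) (perm_big _ pT).
  rewrite !big_cons big_nil.
  by case: (bad_inc x c'); case: (bad_inc y c'); case: (bad_inc z c').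
by rewrite !(negbTE (no _)).
Qed.
End Transversal.

(* In the transversal case the bad fibres of p and q cross in 4 x 4 grids, and
   transposing such a grid preserves Z. *)
Section Grid.
Variables (V V' : eqType) (p : E -> V) (q : E -> V').
Hypotheses (tp : triples p) (tq : triples q).
Hypothesis transversal : forall a b,
  p a = p b -> q a = q b -> ~~ good p q a -> a = b.

Lemma bad_incC r c : bad_inc q p c r = bad_inc p q r c.
Proof. by apply: eq_existsb => g; rewrite andbCA goodC. Qed.

(** Parity holds for columns by [bad_inc_even] and for rows by the same lemma with [p] and [q]
    exchanged, so [incidence_grid] applies. The diagonal entries of [P] carry no information. *)
Lemma bad_grid e0 : ~~ good p q e0 -> exists P : 'I_4 -> 'I_4 -> E,
  [/\ forall i j, i != j -> ~~ good p q (P i j),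
      forall i j k l, i != j -> k != l -> (p (P i j) == p (P k l)) = (j == l) &
      forall i j k l, i != j -> k != l -> (q (P i j) == q (P k l)) = (i == k)].
Proof.
move=> b0.
have tr' a b : q a = q b -> p a = p b -> ~~ good q p a -> a = b.
  by rewrite goodC => *; apply: transversal.
have [R [C [injR injC RC]]] : exists (R : 'I_4 -> V') (C : 'I_4 -> V),
    [/\ injective R, injective C & forall i j, i != j -> bad_inc p q (R i) (C j)].
  apply: (@incidence_grid _ _ _ (q e0) (p e0)).
  - by move=> r c; apply: bad_inc_size.
  - move=> r c; rewrite -bad_incC => /(bad_inc_size tq tr')[s [s3 us ms]].
    by exists s; split=> // t; rewrite -bad_incC [LHS]ms.
  - by move=> *; apply: bad_inc_even.
  - move=> x y z r r' u m rr'; rewrite -!bad_incC; apply: (bad_inc_even tq tp tr' u _ rr').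
    by move=> t; rewrite bad_incC m.
  by apply/existsP; exists e0; rewrite !eqxx.
pose P i j := odflt e0 [pick g | [&& q g == R i, p g == C j & ~~ good p q g]].
have PP i j : i != j -> [/\ q (P i j) = R i, p (P i j) = C j & ~~ good p q (P i j)].
  move=> /RC/existsP[g hg]; rewrite /P; case: pickP => [h /= /and3P[/eqP-> /eqP-> ->]//|].
  by move/(_ g); rewrite hg.
exists P; split=> [i j /PP[] //|i j k l ij kl|i j k l ij kl].
  by have [_ -> _] := PP _ _ ij; have [_ -> _] := PP _ _ kl; rewrite (inj_eq injC).
by have [-> _ _] := PP _ _ ij; have [-> _ _] := PP _ _ kl; rewrite (inj_eq injR).
Qed.
End Grid.
End Triples.

Lemma triples_pull (E E' : finType) (Z : {ffun E -> 'F_2} -> bool)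
    (Z' : {ffun E' -> 'F_2} -> bool) (V : eqType) (p : E' -> V) (f : E -> E') :
  bijective f -> (forall d : {ffun E' -> 'F_2}, Z [ffun e => d (f e)] = Z' d) ->
  triples Z' p -> triples Z (p \o f).
Proof.
move=> bf Zf [p3 pZ pp]; case: (bf) => g fK gK; have f_inj := can_inj fK.
split=> [e|e|d1 d2 Z1 Z2].
- rewrite -(card_imset _ f_inj) -(p3 (f e)); congr #|pred_of_set _|; apply/setP=> x.
  by rewrite -[x]gK mem_imset // !inE /= gK.
- have := pZ (f e); rewrite -Zf; congr (is_true (Z _)).
  by apply/ffunP=> x; rewrite !ffunE !inE /=.
have Zg (d : {ffun E -> 'F_2}) : Z d -> Z' [ffun e => d (g e)].
  by rewrite -Zf; congr (is_true (Z _)); apply/ffunP=> x; rewrite !ffunE fK.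
have := pp _ _ (Zg _ Z1) (Zg _ Z2).
rewrite (reindex f) => [pp0|]; last exact: onW_bij.
rewrite -[RHS]pp0; apply: eq_bigr => e _.
rewrite [RHS](reindex f); last exact: onW_bij.
apply: eq_big => e'.
  by rewrite /= (inj_eq f_inj).
by rewrite !ffunE !fK.
Qed.

(* The cycle space of the complete graph on 'I_4 is spanned by triangles, so a
   symmetric function orthogonal to the triangles is a coboundary. *)
Lemma K4_coboundary (D : 'I_4 -> 'I_4 -> 'F_2) :
  (forall k, \sum_(i | i != k) \sum_(l | (l != i) && (l != k)) D i l = 0) ->
  exists a : 'I_4 -> 'F_2, forall i j, i != j -> D i j + D j i = a i + a j.
Proof.
move=> H; pose Dn m n := D (inord m) (inord n).
have DE i j : D i j = Dn i j by rewrite /Dn !inord_val.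
(* The potential at [i] is the symmetrised value on the edge from 0 to [i]. An edge avoiding 0 is
   settled by the triangle through it and 0, which is the hypothesis for the remaining vertex
   [k]. *)
exists (fun i => if i == ord0 then 0 else D i ord0 + D ord0 i) => i j ij.
have {H} E (k : 'I_4) : \sum_(i < 4) (if i != k then
    \sum_(l < 4) (if (l != i) && (l != k) then Dn i l else 0) else 0) = 0.
  rewrite -[RHS](H k) [RHS]big_mkcond; apply: eq_bigr => i' _; case: ifP => // _.
  by rewrite [RHS]big_mkcond; apply: eq_bigr => l _; rewrite DE.
rewrite !DE; have := (E (@Ordinal 4 1 isT), E (@Ordinal 4 2 isT), E (@Ordinal 4 3 isT)).
rewrite !big_ord_recl !big_ord0 /= /bump /= ?addn0 ?add1n ?addr0 ?add0r.
case: i j ij => [[|[|[|[|?]]]] // ?] [[|[|[|[|?]]]] // ?] //= _ [[E1 E2] E3];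
  rewrite ?add0r ?addr0; try exact: addrC; try done; apply/F2_eq;
  [move: E3|move: E2|move: E3|move: E1|move: E2|move: E1]; move=> <-.
all: by rewrite ?addr0 ?add0r; ring.
Qed.

(** * Alignment by automorphisms of the space of dependencies *)

Section Align.
Variables (E : finType) (Z : {ffun E -> 'F_2} -> bool).
Hypothesis ZD : forall d1 d2 : {ffun E -> 'F_2}, Z d1 -> Z d2 -> Z (d1 + d2).
Hypothesis Z0 : Z 0.
Variables (V V' : eqType) (p : E -> V).

Lemma Z_sum (I : finType) (a : I -> 'F_2) (d : I -> {ffun E -> 'F_2}) :
  (forall i, Z (d i)) -> Z [ffun e => \sum_i a i * d i e].
Proof.
move=> Zd; have -> : [ffun e => \sum_i a i * d i e] = \sum_i (if a i == 0 then 0 else d i).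
  apply/ffunP=> e; rewrite ffunE sum_ffunE; apply: eq_bigr => i _.
  by case: (F2_cases (a i)) => ->; rewrite ?mul0r ?mul1r ?ffunE.
by elim/big_rec: _ => // i d' _ Zd'; apply: ZD => //; case: ifP.
Qed.

(** Fixing the good elements pointwise keeps their triples in [q \o s], and the last clause gains a
    new one; the number of bad elements therefore drops. *)
Definition improves (q : E -> V') (s : {perm E}) := [/\ involutive s, Zauto Z s,
  forall e, good p q e -> s e = e &
  exists2 e, ~~ good p q e & fibre p e = fibre (q \o s) e].

(** The indicators of the two triples add up to that of the pair [c], [d] of third elements.
    Exchanging [c] and [d] changes [x] by a multiple of this sum, which lies in [Z]. *)
Lemma parallel_improves (q : E -> V') a b : triples Z p -> triples Z q ->
  p a = p b -> q a = q b -> ~~ good p q a -> a != b -> exists s, improves q s.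
Proof.
move=> tp tq pab qab bad_a ab.
have [] := @set3_ext _ (fibre p a) a b (triples_card tp a) _ _ ab; rewrite ?inE ?pab //.
move=> c [ca cb fp].
have [] := @set3_ext _ (fibre q a) a b (triples_card tq a) _ _ ab; rewrite ?inE ?qab //.
move=> d [da db fq].
have pc : p c = p a.
  by apply/eqP; rewrite -[_ == _](in_set (fun e => p e == p a)) -/(fibre p a) fp !inE eqxx
    !orbT.
have qd : q d = q a.
  by apply/eqP; rewrite -[_ == _](in_set (fun e => q e == q a)) -/(fibre q a) fq !inE eqxx
    !orbT.
have cd : c != d by apply: contraNneq bad_a => cd; rewrite /good fp fq cd.
exists (tperm c d); split; first exact: tpermK.
- apply: Zauto_involution; first exact: tpermK.
  move=> x Zx.
  have -> : [ffun e => x (tperm c d e)] =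
    x + [ffun e => \sum_(i : bool) (x c + x d) * (if i then indic (fibre p a) else indic (fibre
      q a)) e].
    apply/ffunP=> e; rewrite !ffunE big_bool /= !ffunE fp fq !inE.
    case: tpermP => [->|->|/eqP ec /eqP ed].
    + by rewrite (negbTE ca) (negbTE cb) (negbTE cd) eqxx /= mulr1 mulr0 addr0 addrA F2_addrr
      add0r.
    + rewrite (negbTE da) (negbTE db) eq_sym (negbTE cd) eqxx /= mulr1 mulr0 add0r addrC -addrA.
      by rewrite F2_addrr addr0.
    by rewrite (negbTE ec) (negbTE ed) !orbF F2_addrr addr0.
  apply: ZD => //; apply: Z_sum => -[]; [exact: triples_indic|exact: triples_indic].
- move=> e ge; case: tpermP => // ee; case/negP: bad_a; rewrite ee in ge.
    exact: good_eq pc ge.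
  by rewrite goodC; rewrite goodC in ge; exact: good_eq qd ge.
exists a => //; rewrite fp; apply/setP=> e; rewrite [RHS]inE /= (tpermD ca da).
have := erefl (tperm c d e \in fibre q a); rewrite {1}fq !inE => <-.
case: tpermP => [->|->|/eqP ec /eqP ed].
- by rewrite !eqxx !orbT.
- by rewrite (negbTE da) (negbTE db) (negbTE ca) (negbTE cb) eq_sym (negbTE cd).
by rewrite (negbTE ec) (negbTE ed).
Qed.
Lemma grid_improves (q : E -> V') e0 : triples Z p -> triples Z q ->
  (forall a b, p a = p b -> q a = q b -> ~~ good p q a -> a = b) ->
  ~~ good p q e0 -> exists s, improves q s.
Proof.
move=> tp tq tv bad0; have [P [badP pP qP]] := bad_grid tp tq tv bad0.
have injP i j k l : i != j -> k != l -> (P i j == P k l) = (i == k) && (j == l).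
  move=> ij kl; apply/eqP/andP => [Pe|[/eqP-> /eqP->] //].
  by rewrite -(qP _ _ _ _ ij kl) -(pP _ _ _ _ ij kl) Pe !eqxx.
have card3 (k : 'I_4) : #|predC1 k| = 3%N by rewrite cardC1 card_ord.
have colE i j : i != j -> fibre p (P i j) = [set P k j | k in predC1 j].
  move=> ij; apply/esym/eqP; rewrite eqEcard (triples_card tp) card_in_imset ?card3.
    rewrite andbT; apply/subsetP => e /imsetP[k kj ->]; rewrite inE pP ?eqxx //.
  by move=> k k' kj k'j /eqP; rewrite injP // => /andP[/eqP].
have rowE i j : i != j -> fibre q (P i j) = [set P i l | l in predC1 i].
  move=> ij; apply/esym/eqP; rewrite eqEcard (triples_card tq) card_in_imset ?card3.
    by rewrite andbT; apply/subsetP => e /imsetP[l li ->]; rewrite inE qP // eq_sym.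
  by move=> l l' li l'i /eqP; rewrite injP 1?eq_sym // => /andP[_ /eqP].
pose offd (ij : 'I_4 * 'I_4) e := (ij.1 != ij.2) && (P ij.1 ij.2 == e).
pose t e := if [pick ij | offd ij e] is Some ij then P ij.2 ij.1 else e.
have tP i j : i != j -> t (P i j) = P j i.
  move=> ij; rewrite /t; case: pickP => [[k l] /andP[/= kl]|/(_ (i, j))].
    by rewrite injP // => /andP[/eqP-> /eqP->].
  by rewrite /offd /= ij eqxx.
have offP e : (exists i j, i != j /\ e = P i j) \/ (forall i j, i != j -> P i j != e).
  case: (pickP (offd^~ e)) => [[k l] /andP[/= kl /eqP<-]|no]; first by left; exists k, l.
  by right=> i j ij; have := no (i, j); rewrite /offd /= ij /= => ->.
have tfix e : (forall i j, i != j -> P i j != e) -> t e = e.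
  by move=> h; rewrite /t; case: pickP => // -[i j] /andP[/= /h /negbTE->].
have tK : involutive t.
  move=> e; case: (offP e) => [[i [j [ij ->]]]|h]; last by rewrite !tfix // tfix.
  by rewrite !tP // eq_sym.
pose s := perm (inv_inj tK); have sE e : s e = t e by rewrite permE.
have sK : involutive s by move=> e; rewrite !sE tK.
(* [o i] is some index other than [i]: it serves to name column [i] by [P (o i) i] and row [i] by
   [P i (o i)]. *)
pose o (i : 'I_4) : 'I_4 := if i == ord0 then lift ord0 ord0 else ord0.
have oi i : o i != i by rewrite /o; have [->|ni] := eqVneq i ord0; rewrite // eq_sym.
have io i : i != o i by rewrite eq_sym.
exists s; split=> //.
- apply: Zauto_involution => // d Zd.
  (* The triangle condition is the isotropy for [q] between the indicator of column [k] and [d]: the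
     entry of that column in row [i] is paired with the other two entries of row [i]. *)
  have [k|a aE] := @K4_coboundary (fun i l => d (P i l)).
    have := triples_pairing tq (triples_indic tp (P (o k) k)) Zd.
    under eq_bigr do rewrite -mulr_sumr ffunE.
    rewrite (bigID (mem (fibre p (P (o k) k)))) /= [X in _ + X]big1 ?addr0; last first.
      by move=> e /negbTE->; rewrite mul0r.
    under eq_bigr => e eT do rewrite eT mul1r.
    rewrite colE // big_imset /=; last first.
      by move=> i i' ik i'k /eqP; rewrite injP // => /andP[/eqP].
    move=> pair0; rewrite -[RHS]pair0; apply: eq_bigr => i ik.
    rewrite (eq_bigl (fun e => (e \in fibre q (P i k)) && (e != P i k))); last first.
      by move=> e; rewrite inE.
    rewrite rowE // big_imset_cond /=; last first.
      by move=> l l' li l'i /eqP; rewrite injP 1?eq_sym // => /andP[_ /eqP].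
    apply: eq_bigl => l; rewrite !inE; case: eqVneq => //= li.
    by rewrite injP ?eqxx // eq_sym.
  (* At the entry [(i, j)] only column [j] and row [i] count, giving [a i + a j], which is the
     change of [d] under transposition. *)
  have -> : [ffun e => d (s e)] = d + [ffun e => \sum_i a i *
      (indic (fibre p (P (o i) i)) + indic (fibre q (P i (o i)))) e].
    apply/ffunP=> e; rewrite !ffunE sE; case: (offP e) => [[i [j [ij ->]]]|h].
      rewrite tP // (eq_bigr (fun k => a k * (j == k)%:R + a k * (i == k)%:R)); last first.
        by move=> k _; rewrite !ffunE !inE pP // qP // mulrDr.
      rewrite big_split /= (bigD1 j) //= eqxx mulr1 big1 ?addr0; last first.
        by move=> k kj; rewrite eq_sym (negbTE kj) mulr0.
      rewrite (bigD1 i) //= eqxx mulr1 big1 ?addr0; last first.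
        by move=> k ki; rewrite eq_sym (negbTE ki) mulr0.
      by rewrite [a j + _]addrC -(aE _ _ ij) addrA F2_addrr add0r.
    rewrite tfix // big1 ?addr0 // => k _; rewrite !ffunE colE // rowE //.
    case: imsetP => [[l lk el]|_]; first by move: (h l k lk); rewrite el eqxx.
    case: imsetP => [[l lk el]|_]; first by move: (h k l); rewrite el eqxx eq_sym => /(_ lk).
    by rewrite addr0 mulr0.
  apply: ZD => //; apply: Z_sum => i.
  by apply: ZD; [exact: triples_indic|exact: triples_indic].
- move=> e ge; rewrite sE tfix // => i j ij.
  by apply: contraTneq ge => <-; exact: badP.
pose o0 : 'I_4 := ord0; pose o1 : 'I_4 := lift ord0 ord0.
(* Transposition carries column [o1] onto row [o1], so this [p]-triple becomes a triple of
   [q \o s]. *)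
exists (P o0 o1); first exact: badP.
apply/setP=> e; rewrite [RHS]inE /= !sE tP //.
have -> : (q (t e) == q (P o1 o0)) = (t e \in fibre q (P o1 o0)) by rewrite inE.
rewrite rowE // colE //; apply/imsetP/imsetP => -[k kj ek]; exists k => //.
  by rewrite ek tP.
by rewrite -[e]tK ek tP // eq_sym.
Qed.

Lemma improvement (q : E -> V') e0 : triples Z p -> triples Z q ->
  ~~ good p q e0 -> exists s, improves q s.
Proof.
move=> tp tq b0.
case: (boolP [exists a, exists b, [&& p a == p b, q a == q b, ~~ good p q a & a != b]]).
  by case/existsP=> a /existsP[b /and4P[/eqP pab /eqP qab ba ab]]; apply: parallel_improves ab.
move=> no; apply: (@grid_improves _ e0) => // a b pab qab ba; apply/eqP/negPn/negP => ab.
by case/negP: no; apply/existsP; exists a; apply/existsP; exists b; rewrite pab qab ba ab !eqxx.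
Qed.

Lemma improves_good (q : E -> V') s e : improves q s -> good p q e -> good p (q \o s) e.
Proof.
case=> sK _ sfix _ ge; rewrite /good (eqP ge); apply/eqP/setP=> x; rewrite !inE /= (sfix _ ge).
apply/idP/idP=> [/eqP qx|/eqP qx].
  have gx : good p q x by rewrite goodC; apply: (good_eq (esym qx)); rewrite goodC.
  by rewrite sfix ?qx.
have gx : good p q (s x) by rewrite goodC; apply: (good_eq (esym qx)); rewrite goodC.
by rewrite -(sK x) -qx sfix.
Qed.

(** Induction on the number of bad elements: each improvement replaces [q] by [q \o s], and when all
    elements are good [p] and [q] have the same fibres. *)
Theorem triples_align (q : E -> V') : triples Z p -> triples Z q ->
  exists2 s : {perm E}, Zauto Z s &
    forall e e', (q (s e) == q (s e')) = (p e == p e').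
Proof.
have [n] := ubnP #|[set e | ~~ good p q e]|; elim: n q => // n IHn q ltn tp tq.
case: (pickP (fun e => ~~ good p q e)) => [e0 b0|allg]; last first.
  exists 1%g => [d|e e']; first by congr (Z _); apply/ffunP=> e; rewrite !ffunE perm1.
  by rewrite !perm1 (@good_mem _ _ _ p q) //; exact: negbFE (allg e').
have [s imp] := improvement tp tq b0.
have [sK Zs _ [e1 b1 e1E]] := imp.
have [|//||s' Zs' s'P] := IHn (q \o s); last 2 first.
- exact: triples_pull (injF_bij (@perm_inj _ s)) Zs tq.
- exists (s' * s)%g => [d|e e']; last by rewrite !permM s'P.
  rewrite -(Zs d) -(Zs' [ffun e => d (s e)]); congr (Z _); apply/ffunP=> e.
  by rewrite !ffunE permM.
rewrite -ltnS; apply: leq_trans ltn; rewrite ltnS; apply: proper_card; apply/properP; split.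
  by apply/subsetP=> e; rewrite !inE; apply: contraNN; exact: improves_good.
by exists e1; rewrite inE ?b1 // negbK /good e1E.
Qed.

End Align.

(** * Cuts and the cycle matroid *)

Section Cuts.
Variable G : multigraph.
Hypothesis endsP : forall e : mg_edge G, exists x y, mg_ends e = [set x; y].
Implicit Types (X : {set mg_vertex G}) (S : {set mg_edge G}).

Definition crosses X (e : mg_edge G) : bool :=
  ~~ (mg_ends e \subset X) && ~~ (mg_ends e \subset ~: X).

Lemma crossesE X e x y : mg_ends e = [set x; y] ->
  crosses X e = (x \in X) (+) (y \in X).
Proof.
rewrite /crosses => ->; rewrite !subUset !sub1set !inE.
by case: (x \in X); case: (y \in X).
Qed.

(* A walk x, p_1, .., p_k avoiding repeated vertices, as the sequence of
   (vertex, edge) pairs that [mg_cycle] expects, stopping before the last vertex. *)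
Lemma uniq_walk S x p : uniq (x :: p) ->
  path (fun u v => [exists e in S, mg_ends e == [set u; v]]) x p ->
  exists s : seq (mg_vertex G * mg_edge G),
    [/\ unzip1 s = belast x p, uniq (unzip2 s), {subset unzip2 s <= S},
        (forall e, e \in unzip2 s -> {subset mg_ends e <= x :: p}) &
        forall e, path (fun x y => mg_ends x.2 == [set x.1; y.1])
                    (head (last x p, e) s) (behead (rcons s (last x p, e)))].
Proof.
elim: p x => [|y p IHp] x /=; first by move=> _ _; exists [::].
move=> /andP[xp up] /andP[/exists_inP[e0 e0S /eqP e0E] pp].
have [s [s1 s2 sS sV sP]] := IHp y up pp; exists ((x, e0) :: s); split=> /=.
- by rewrite s1.
- rewrite s2 andbT; apply: contra xp => /sV; apply.
  by rewrite e0E !inE eqxx.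
- by move=> e; rewrite inE => /orP[/eqP->|/sS].
- move=> e; rewrite inE => /orP[/eqP->|/sV sub] t.
    by rewrite e0E !inE => /orP[]/eqP->; rewrite eqxx ?orbT.
  by move=> /sub; rewrite [in X in _ -> X]inE => ->; rewrite orbT.
move=> e; have := sP e; case: s s1 {s2 sS sV sP} => [|[z e1] s] /=.
  by case: p {IHp xp up pp} => //= _; rewrite e0E eqxx.
by case: p {IHp xp up pp} => //= z' p [-> _] ->; rewrite e0E eqxx.
Qed.

(** In a forest, the component of one end of [e] in [S :\ e] gives a cut that meets [S] in [e]
    alone. Conversely, no cut meets a cycle in a single edge. *)
Lemma cycle_matroidP S : cycle_matroid S <->
  (forall e, e \in S -> exists X, forall e', e' \in S -> crosses X e' = (e' == e)).
Proof.
split=> [acyc e eS|cuts [[//|[x0 e0] p] /and4P[_ _ /= /andP[e0p _] cp] pS]].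
  have [x [y exy]] := endsP e.
  pose r := fun u v => [exists e' in S :\ e, mg_ends e' == [set u; v]].
  pose X := [set z | connect r x z].
  have [yX|yX] := boolP (y \in X).
    (* A path in [S :\ e] between the ends of [e] closes up with [e] to a cycle. *)
    case: acyc; move: yX; rewrite inE => /connectP[p0 /shortenP[p pp up _] yE]; subst y.
    have [s [s1 s2 sS _ sP]] := uniq_walk up pp.
    exists (rcons s (last x p, e)).
      apply/and4P; split; first by case: (s).
      - by rewrite /unzip1 map_rcons -/(unzip1 s) s1 -lastI.
      - rewrite /unzip2 map_rcons rcons_uniq s2 andbT.
        by apply/negP=> /sS; rewrite !inE eqxx.
      have := sP e; case: s s1 {s2 sS sP} => [|[z e1] s] /= s1.
        by case: p s1 {up pp} exy => //= _ ->; rewrite eqxx.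
      case: p s1 {up pp} exy => //= a p [<- _] exy.
      by move=> sP; rewrite rcons_path sP last_rcons exy setUC eqxx.
    move=> e'; rewrite /unzip2 map_rcons mem_rcons inE => /orP[/eqP->//|/sS].
    by rewrite inE => /andP[].
  exists X => e' e'S; have [->|ne] := eqVneq e' e.
    by rewrite (crossesE _ exy) (negbTE yX) inE connect0.
  have [u [v e'uv]] := endsP e'; rewrite (crossesE _ e'uv).
  have ruv : r u v by apply/exists_inP; exists e'; rewrite ?inE ?ne ?e'uv.
  have rvu : r v u by apply/exists_inP; exists e'; rewrite ?inE ?ne ?e'uv 1?setUC.
  rewrite !inE; apply: negbTE; rewrite negb_add; apply/eqP; apply/idP/idP => xc.
    exact: connect_trans xc (connect1 ruv).
  exact: connect_trans xc (connect1 rvu).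
have [|X cutX] := cuts e0; first by apply: pS; rewrite inE eqxx.
(* The edges of the cycle other than [e0] do not cross [X], so the rest of the cycle stays on one
   side and so do both ends of [e0]. *)
have step y z q : {subset unzip2 (y :: q) <= unzip2 p} ->
    path (fun x y => mg_ends x.2 == [set x.1; y.1]) y (rcons q z) ->
    (y.1 \in X) = (z.1 \in X).
  elim: q y => [|t q IHq] y yp /= /andP[yt tq].
    have ye : y.2 \in unzip2 p by apply: yp; rewrite /= inE eqxx.
    have := cutX y.2; rewrite pS ?inE ?ye ?orbT // (crossesE _ (eqP yt)) => /(_ isT) h.
    by apply/eqP; rewrite -negb_add h; apply: contraNneq e0p => <-.
  have ye : y.2 \in unzip2 p by apply: yp; rewrite /= inE eqxx.
  rewrite -(IHq t) //; last by move=> e eq; apply: yp; rewrite /= inE eq orbT.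
  have := cutX y.2; rewrite pS ?inE ?ye ?orbT // (crossesE _ (eqP yt)) => /(_ isT) h.
  by apply/eqP; rewrite -negb_add h; apply: contraNneq e0p => <-.
have := cutX e0; rewrite eqxx pS ?inE ?eqxx // => /(_ isT).
case: p cp e0p pS step => [|y q] /= .
  by rewrite andbT => /eqP/crossesE-> _ _ _; rewrite addbb.
move=> /andP[/eqP/crossesE-> yq] e0p pS step.
by rewrite -(step y (x0, e0) q) ?addbb.
Qed.

End Cuts.

(** * Transitions and cycles of a 4-regular graph *)

(** Membership in a row space is tested against the cokernel of the matrix, whose columns are
    solutions [x] of the system. *)
Lemma orthogonal_dual (K : fieldType) (I J : finType) (A : I -> J -> K) (b : J -> K) :
  (forall x : J -> K, (forall i, \sum_j A i j * x j = 0) -> \sum_j b j * x j = 0) ->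
  exists a : I -> K, forall j, b j = \sum_i a i * A i j.
Proof.
move=> h; pose M := \matrix_(i < #|I|, j < #|J|) A (enum_val i) (enum_val j).
pose u := \row_(j < #|J|) b (enum_val j).
have sumJ (G : J -> K) : \sum_j G j = \sum_(j < #|J|) G (enum_val j).
  by rewrite (reindex (fun j : 'I_#|J| => enum_val j)) //; apply: onW_bij; exact: enum_val_bij.
have sumI (G : I -> K) : \sum_j G j = \sum_(j < #|I|) G (enum_val j).
  by rewrite (reindex (fun j : 'I_#|I| => enum_val j)) //; apply: onW_bij; exact: enum_val_bij.
have /submxP[D uD] : (u <= M)%MS.
  rewrite submxE; apply/eqP/matrixP=> i k; rewrite mxE [RHS]mxE.
  have := h (fun j => cokermx M (enum_rank j) k); rewrite sumJ.
  move=> hk; rewrite -[RHS]hk => [|i'].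
    by apply: eq_bigr => j _; rewrite !mxE enum_valK.
  have := mulmx_coker M; move/matrixP/(_ (enum_rank i') k).
  rewrite mxE [RHS]mxE sumJ => coker0; rewrite -[RHS]coker0.
  by apply: eq_bigr => j _; rewrite !mxE enum_valK enum_rankK.
exists (fun i => D 0 (enum_rank i)) => j.
move/matrixP/(_ 0 (enum_rank j)): uD; rewrite !mxE enum_rankK => ->.
by rewrite sumI; apply: eq_bigr => i _; rewrite !mxE enum_rankK enum_valK.
Qed.

Section Transitions.
Variable F : graph4.
Implicit Types (v : vertex F) (h k : half_edge F) (t : transition F).
Implicit Types (x y : half_edge F -> 'F_2) (d : {ffun transition F -> 'F_2}).

Definition star v : {set half_edge F} := [set h | vtx h == v].

Lemma card_star v : #|star v| = 4%N.
Proof. exact: graph4_regular. Qed.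

Definition pairing_with v h k : {set {set half_edge F}} :=
  [set [set h; k]; star v :\: [set h; k]].

Lemma card_starD v h k : vtx h = v -> vtx k = v -> k != h ->
  #|star v :\: [set h; k]| = 2%N.
Proof.
move=> hv kv kh; have sub : [set h; k] \subset star v.
  by apply/subsetP=> z; rewrite !inE => /orP[]/eqP->; rewrite ?hv ?kv.
by rewrite cardsD card_star (setIidPr sub) cards2 eq_sym kh.
Qed.

Lemma pairing_with_transition v h k : vtx h = v -> vtx k = v -> k != h ->
  is_transition v (pairing_with v h k).
Proof.
move=> hv kv kh; have c2 := card_starD hv kv kh.
have hk2 : #|[set h; k]| = 2%N by rewrite cards2 eq_sym kh.
have sub : [set h; k] \subset star v.
  by apply/subsetP=> z; rewrite !inE => /orP[]/eqP->; rewrite ?hv ?kv.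
apply/andP; split; last first.
  by apply/forall_inP=> A; rewrite !inE => /orP[]/eqP->; rewrite ?hk2 ?c2.
apply/and3P; split.
- rewrite /cover bigcup_setU !big_set1; apply/eqP/setP=> z.
  by rewrite -/(star v) -[in RHS](setID (star v) [set h; k]) (setIidPr sub).
- apply/trivIsetP=> A B; rewrite !inE => /orP[]/eqP-> /orP[]/eqP->; rewrite ?eqxx //.
    by rewrite disjoints_subset setCD subsetUr.
  by rewrite disjoint_sym disjoints_subset setCD subsetUr.
by rewrite !inE negb_or ![set0 == _]eq_sym -!card_gt0 hk2 c2.
Qed.

Lemma transition_pairing v T h : is_transition v T -> vtx h = v ->
  exists k, [/\ vtx k = v, k != h & T = pairing_with v h k].
Proof.
move=> /andP[pT /forall_inP T2] hv; have [/eqP cT tT T0] := and3P pT.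
have hT : h \in cover T by rewrite cT inE hv.
have AT := pblock_mem hT; have hA := (mem_pblock T h).
rewrite hT in hA; set A := pblock T h in AT hA; clearbody A.
have /cards2P[a [b [ab AE]]] : #|A| == 2 by exact: T2.
have [k kh {a b ab}AE] : exists2 k, k != h & A = [set h; k].
  move: hA; rewrite AE !inE => /orP[]/eqP hh; rewrite -hh in AE ab *.
    by exists b; rewrite // eq_sym.
  by exists a; rewrite // setUC.
have sub B : B \in T -> B \subset star v.
  by move=> BT; rewrite /star -cT; apply: bigcup_max BT _.
have kv : vtx k = v.
  by apply/eqP; have /subsetP/(_ k) := sub _ AT; rewrite AE !inE eqxx orbT => /(_ isT).
exists k; split=> //; apply/eqP; rewrite eq_sym eqEcard /pairing_with.
have cardT : #|T| = 2%N.
  have := card_uniform_partition (n := 2) _ pT; rewrite card_star => /(_ _)/eqP.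
  by rewrite (_ : 4 = 2 * 2)%N // eqn_pmul2r // => h4; apply/esym/eqP/h4 => B /T2/eqP.
rewrite cardT -AE; apply/andP; split; last first.
  by rewrite cards2; case: eqP => // /setP/(_ h); rewrite inE hA.
have [B BT BA] : exists2 B, B \in T & B != A.
  have : (0 < #|T :\ A|)%N by have := cardsD1 A T; rewrite AT cardT add1n => -[<-].
  by case/card_gt0P=> B; rewrite !inE => /andP[BA BT]; exists B.
have BE : B = star v :\: A.
  apply/eqP; rewrite eqEcard; apply/andP; split; last by rewrite AE card_starD // (eqP (T2 _
    BT)).
  rewrite subsetD sub //=.
  by have /trivIsetP := tT; apply.
by apply/subsetP=> D; rewrite !inE -BE => /orP[]/eqP->.
Qed.

(** The default [h] is the value for half-edges that do not lie at the vertex of [t]. *)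
Definition partner t h : half_edge F :=
  odflt h [pick k | (k != h) && ([set h; k] \in tpairs t)].

Lemma partner_eq t h k : k != h -> [set h; k] \in tpairs t -> partner t h = k.
Proof.
move=> kh hk; rewrite /partner; case: pickP => [k' /andP[k'h hk']|/(_ k)] /=; last by rewrite
  kh hk.
have /andP[/and3P[_ tT _] _] := valP t.
have h1 : h \in [set h; k] by rewrite !inE eqxx.
have h2 : h \in [set h; k'] by rewrite !inE eqxx.
have := def_pblock tT hk h1; rewrite (def_pblock tT hk' h2) => /setP/(_ k').
by rewrite !inE eqxx orbT (negbTE k'h) /= => /esym/eqP.
Qed.

Lemma partnerP t h : vtx h = tvertex t ->
  [/\ vtx (partner t h) = tvertex t, partner t h != h &
      tpairs t = pairing_with (tvertex t) h (partner t h)].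
Proof.
move=> hv; have [k [kv kh tE]] := transition_pairing (valP t) hv.
suff -> : partner t h = k by [].
by apply: partner_eq => //; rewrite /tpairs tE !inE eqxx.
Qed.

Lemma partnerK t h : vtx h = tvertex t -> partner t (partner t h) = h.
Proof.
move=> hv; have [kv kh tE] := partnerP hv.
by apply: partner_eq; rewrite 1?eq_sym // tE setUC !inE eqxx.
Qed.

Lemma partner_inj t t' h : vtx h = tvertex t -> vtx h = tvertex t' ->
  partner t h = partner t' h -> t = t'.
Proof.
move=> hv hv' e; have [_ _ tE] := partnerP hv; have [_ _ tE'] := partnerP hv'.
apply: val_inj; rewrite [val t]surjective_pairing [val t']surjective_pairing.
by rewrite -/(tvertex t) -/(tvertex t') -/(tpairs t) -/(tpairs t') tE tE' e -hv hv'.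
Qed.

(** Together with [partner_inj], this parametrises the transitions at a vertex by the partner of a
    fixed half-edge. *)
Lemma partner_surj h k : vtx k = vtx h -> k != h ->
  exists2 t, tvertex t = vtx h & partner t h = k.
Proof.
move=> kv kh; exists (Sub (vtx h, _) (pairing_with_transition (erefl (vtx h)) kv kh) :
  transition F) => //.
by apply: partner_eq; rewrite // /tpairs /= !inE eqxx.
Qed.

Lemma star_nonempty v : exists h, vtx h == v.
Proof.
have /card_gt0P[h] : (0 < #|star v|)%N by rewrite card_star.
by rewrite inE; exists h.
Qed.

Definition ref v : half_edge F := xchoose (star_nonempty v).

Lemma vtx_ref v : vtx (ref v) = v.
Proof. exact/eqP/(xchooseP (star_nonempty v)). Qed.

Lemma sum_star4 (K : zmodType) (f : half_edge F -> K) v a b c e :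
  uniq [:: a; b; c; e] -> all (fun h => vtx h == v) [:: a; b; c; e] ->
  \sum_(h | vtx h == v) f h = f a + f b + f c + f e.
Proof.
move=> u av; have sE : star v = [set h in [:: a; b; c; e]].
  apply/esym/eqP; rewrite eqEcard card_star (cardsE (mem [:: a; b; c; e])) (card_uniqP u) leqnn
    andbT.
  by apply/subsetP=> h; rewrite inE => /(allP av); rewrite inE.
rewrite (eq_bigl (mem [:: a; b; c; e])) => [|h].
  by rewrite -big_uniq //= !big_cons big_nil addr0 !addrA.
by have /setP/(_ h) := sE; rewrite !inE.
Qed.

(** A set of edges is encoded on half-edges, so that a loop counts twice at its vertex. *)
Definition even_cycle x := (forall h, x (mate h) = x h) /\
  (forall v, \sum_(h | vtx h == v) x h = 0).

Definition tr_value t x : 'F_2 := x (ref (tvertex t)) + x (partner t (ref (tvertex t))).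

(** The four values of [x] at the vertex sum to zero, hence the two pairs of [t] give the same value
    and the reference half-edge does not matter. *)
Lemma tr_valueE t x h : even_cycle x -> vtx h = tvertex t -> tr_value t x = x h + x (partner t
  h).
Proof.
move=> [_ cx] hv; have rv := vtx_ref (tvertex t); rewrite /tr_value.
set r := ref _ in rv *; have [rv' rr' _] := partnerP rv; have [hv' hh' _] := partnerP hv.
have [->//|hr] := eqVneq h r.
have [->|hr'] := eqVneq h (partner t r); first by rewrite partnerK // addrC.
apply: F2_eq; rewrite -[RHS](cx (tvertex t)) (sum_star4 _ (a:=r) (b := partner t r) (c := h) (e
  := partner t h)).
- by rewrite !addrA.
- rewrite /= !inE !negb_or ![r == _]eq_sym rr' hr /= ![partner t r == _]eq_sym hr' /=.
  rewrite [h == _]eq_sym hh' !andbT; apply/andP; split.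
    by apply: contraNneq hr' => e; rewrite -e partnerK.
  by apply: contraNneq hr => e; rewrite -(partnerK hv) e partnerK.
by rewrite /= rv rv' hv hv' eqxx.
Qed.

Lemma sum_mate x y : (forall h, x (mate h) = x h) -> (forall h, y (mate h) = y h) ->
  \sum_h y h * x h = 0.
Proof.
(* [P] selects one half of each edge; the two halves contribute equally and cancel. *)
move=> xm ym; pose P h := (enum_rank h < enum_rank (mate h))%N.
rewrite (bigID P) /= [X in _ + X](reindex_inj (inv_inj (@mateK F))) /=.
rewrite [X in _ + X](eq_big P (fun h => y h * x h)) ?F2_addrr // => h.
  rewrite /P mateK -leqNgt leq_eqVlt; case: eqP => // /val_inj/enum_rank_inj e.
  by have := mate_neq h; rewrite -e eqxx.
by rewrite xm ym.
Qed.

Definition cycle_orthogonal d := forall x, even_cycle x -> \sum_t d t * tr_value t x = 0.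

(* The isotropy of the transition matroid: a dependency d is itself a cycle of F,
   seen through the transitions. *)
Lemma cycle_orthogonalP d : cycle_orthogonal d <-> exists2 y, even_cycle y &
  forall t, tr_value t y = \sum_(t' | (tvertex t' == tvertex t) && (t' != t)) d t'.
Proof.
(* [b] represents the functional that [d] induces on all functions of half-edges through
   [tr_value]. *)
pose b h := \sum_t d t * ((h == ref (tvertex t))%:R + (h == partner t (ref (tvertex t)))%:R).
have bx x : \sum_h b h * x h = \sum_t d t * tr_value t x.
  under eq_bigr do rewrite mulr_suml.
  rewrite exchange_big; apply: eq_bigr => t _.
  rewrite (eq_bigr (fun h => d t * ((h == ref (tvertex t))%:R * x h + (h == partner t (ref
    (tvertex t)))%:R * x h))); last first.
    by move=> h _; rewrite -mulrA mulrDl.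
  rewrite -mulr_sumr big_split /= /tr_value; congr (_ * (_ + _)).
    rewrite (bigD1 (ref (tvertex t))) //= eqxx mul1r big1 ?addr0 // => h /negbTE->.
    by rewrite mul0r.
  rewrite (bigD1 (partner t (ref (tvertex t)))) //= eqxx mul1r big1 ?addr0 // => h /negbTE->.
  by rewrite mul0r.
have bt t : b (ref (tvertex t)) + b (partner t (ref (tvertex t))) =
    \sum_(t' | (tvertex t' == tvertex t) && (t' != t)) d t'.
  have rv := vtx_ref (tvertex t); set r := ref _ in rv *.
  have [rv' rr' _] := partnerP rv.
  rewrite -big_split /= [RHS]big_mkcond; apply: eq_bigr => t' _; rewrite -mulrDr.
  have rv2 := vtx_ref (tvertex t'); have [rv2' _ _] := partnerP rv2.
  case: (eqVneq (tvertex t') (tvertex t)) => [e|ne] /=.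
    have -> : ref (tvertex t') = r by rewrite e.
    have rt' : vtx r = tvertex t' by rewrite e.
    have [_ rr2 _] := partnerP rt'.
    rewrite eqxx (eq_sym r) (negbTE rr2) (negbTE rr') addr0 add0r.
    case: (eqVneq t' t) => [->|net]; first by rewrite eqxx F2_addrr mulr0.
    rewrite (_ : _ == _ = false) ?addr0 ?mulr1 //.
    by apply: contraNF net => /eqP pe; apply/eqP; apply: (@partner_inj _ _ r).
  have nv h k : vtx h = tvertex t -> vtx k = tvertex t' -> (h == k) = false.
    by move=> hv kv; apply: contraNF ne => /eqP hk; rewrite -kv -hk hv.
  by rewrite !nv // !addr0 mulr0.
split=> [Zd|[y cy yl] x cx].
  (* The rows are the equations of an even cycle, one for each vertex and one for each half-edge, so
     [b] is a combination of them by duality. *)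
  pose Adj (i : vertex F + half_edge F) h : 'F_2 :=
    match i with inl v => (vtx h == v)%:R | inr k => (h == k)%:R + (h == mate k)%:R end.
  have [|a bE] := @orthogonal_dual _ _ _ Adj b.
    move=> x xA; rewrite bx; apply: Zd; split=> [h|v].
      have := xA (inr h); rewrite /Adj /=; under eq_bigr do rewrite mulrDl.
      rewrite big_split /= (bigD1 h) //= eqxx mul1r big1 ?addr0; last first.
        by move=> k /negbTE->; rewrite mul0r.
      rewrite (bigD1 (mate h)) //= eqxx mul1r big1 ?addr0; last first.
        by move=> k /negbTE->; rewrite mul0r.
      by move/F2_eq->.
    rewrite -[RHS](xA (inl v)) big_mkcond /=; apply: eq_bigr => h _.
    by case: eqP; rewrite ?mul1r ?mul0r.
  (* The edge part of the combination is invariant under [mate] and differs from [b] by a function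
     constant at each vertex; such a constant drops out of [tr_value] and of the sum over four
     half-edges. *)
  pose y h := a (inr h) + a (inr (mate h)).
  have by_ h : b h = a (inl (vtx h)) + y h.
    rewrite bE big_sumType /= (bigD1 (vtx h)) //= eqxx mulr1 big1 ?addr0; last first.
      by move=> v; rewrite eq_sym => /negbTE->; rewrite mulr0.
    congr (_ + _); under eq_bigr do rewrite mulrDr; rewrite big_split /=; congr (_ + _).
      rewrite (bigD1 h) //= eqxx mulr1 big1 ?addr0 // => k.
      by rewrite eq_sym => /negbTE->; rewrite mulr0.
    rewrite (bigD1 (mate h)) //= mateK eqxx mulr1 big1 ?addr0 // => k.
    by rewrite eq_sym (can2_eq (@mateK F) (@mateK F)) => /negbTE->; rewrite mulr0.
  have yb h : y h = b h + a (inl (vtx h)) by rewrite by_ addrAC F2_addrr add0r.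
  exists y; last first.
    move=> t; rewrite /tr_value !yb -bt; have rv := vtx_ref (tvertex t).
    have [-> _ _] := partnerP rv; rewrite rv.
    by rewrite addrACA F2_addrr addr0.
  split=> [h|v]; first by rewrite /y mateK addrC.
  under eq_bigr => h hv do rewrite yb (eqP hv).
  rewrite big_split /= sumr_const -/(star v) (_ : #|_| = 4%N); last first.
    by rewrite -(card_star v); apply: eq_card => h; rewrite inE.
  rewrite -[X in _ + X]mulr_natr (_ : 4%:R = 0) ?mulr0 ?addr0; last exact: val_inj.
  rewrite exchange_big /= big1 // => t _; rewrite -mulr_sumr big_split /=.
  have rv := vtx_ref (tvertex t); have [rv' _ _] := partnerP rv.
  have sum1 k : \sum_(h | vtx h == v) (h == k)%:R = (vtx k == v)%:R :> 'F_2.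
    case: (boolP (vtx k == v)) => kv; last by rewrite big1 // => h hv; case: eqP => // hk;
      rewrite -hk hv in kv.
    by rewrite (bigD1 k) //= eqxx big1 ?addr0 // => h /andP[_ /negbTE->].
  by rewrite !sum1 rv rv' F2_addrr mulr0.
rewrite -bx; have [ym ys] := cy; have [xm xs] := cx.
(* Equal transition values make [b + y] constant at each vertex, hence orthogonal to the cycle [x];
   the rest is [sum_mate]. *)
have byc h : b h + y h = b (ref (vtx h)) + y (ref (vtx h)).
  have [<-//|hr] := eqVneq h (ref (vtx h)).
  have rv := vtx_ref (vtx h).
  have [|t tv pt] := @partner_surj (ref (vtx h)) h _ hr; first by rewrite rv.
  rewrite rv in tv; have := yl t; rewrite -bt tv /tr_value tv pt => e.
  apply: F2_eq; rewrite addrACA [b h + _]addrC -e [y h + _]addrC; exact: F2_addrr.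
rewrite (eq_bigr (fun h => (b h + y h) * x h + y h * x h)); last first.
  by move=> h _; rewrite -mulrDl -addrA F2_addrr addr0.
rewrite big_split /= (sum_mate xm ym) addr0 (partition_big (@vtx F) predT) //= big1 // => v _.
under eq_bigr => h hv do rewrite byc (eqP hv).
by rewrite -mulr_sumr xs mulr0.
Qed.

End Transitions.

(** * Circuit partitions and touch-graphs *)

Lemma uniq_flatten_nth (S T : eqType) (f : S -> seq T) (s : seq S) x0 i j x :
  uniq (flatten (map f s)) -> (i < size s)%N -> (j < size s)%N ->
  x \in f (nth x0 s i) -> x \in f (nth x0 s j) -> i = j.
Proof.
elim: s i j => // y s IHs [|i] [|j] //= u ilt jlt xi xj.
- move: u; rewrite cat_uniq => /and3P[_ /hasPn/(_ x) + _]; rewrite xi.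
  by case/(_ _)/negP => //; apply/flatten_mapP; exists (nth x0 s j); rewrite ?mem_nth.
- move: u; rewrite cat_uniq => /and3P[_ /hasPn/(_ x) + _]; rewrite xj.
  by case/(_ _)/negP => //; apply/flatten_mapP; exists (nth x0 s i); rewrite ?mem_nth.
by congr _.+1; apply: IHs => //; move: u; rewrite cat_uniq => /and3P[].
Qed.

HB.instance Definition _ (F : graph4) := [isSub for @circuit_seq F].
HB.instance Definition _ (F : graph4) := [Equality of circuit F by <:].

Section Circuit.
Variables (F : graph4) (c : circuit F).

Lemma circuit_uniq : uniq c.
Proof. by have /and3P[_] := circuitP c; rewrite cat_uniq => /andP[]. Qed.

Lemma circuit_mate h : h \in (c : seq _) -> mate h \notin (c : seq _).
Proof.
have /and3P[_ + _] := circuitP c; rewrite cat_uniq => /and3P[_ /hasPn ncm _] hc.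
by apply: ncm; apply: map_f.
Qed.

Lemma mem_halves h : h \in circuit_halves c = (h \in (c : seq _)) || (mate h \in (c : seq _)).
Proof.
rewrite mem_cat; congr orb; apply/mapP/idP => [[k kc ->]|mc]; first by rewrite mateK.
by exists (mate h); rewrite ?mateK.
Qed.

Lemma circuit_next h : h \in (c : seq _) -> vtx (next c h) = vtx (mate h).
Proof. by have /and3P[_ _ cc] := circuitP c => /(next_cycle cc)/eqP. Qed.

End Circuit.

Section Partition.
Variables (F : graph4) (P : circuit_partition F).
Implicit Types (h k : half_edge F) (v : vertex F).

Definition circ (i : 'I_(size P)) : circuit F := tnth (in_tuple P) i.

Lemma circ_nth c i : circ i = nth c P i.
Proof. by rewrite /circ (tnth_nth c). Qed.

Lemma circ_exists h : exists i, h \in circuit_halves (circ i).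
Proof.
have : h \in flatten (map (@circuit_halves F) P).
  by rewrite (perm_mem (circuit_partitionP P)) mem_enum.
case/flatten_mapP=> c cP hc; have ilt : (find (fun c => h \in circuit_halves c) P < size P)%N.
  by rewrite -has_find; apply/hasP; exists c.
exists (Ordinal ilt); rewrite (circ_nth c).
by apply: (nth_find c (a := fun c => h \in circuit_halves c)); rewrite has_find.
Qed.

Definition circuit_index h : 'I_(size P) := xchoose (circ_exists h).

Lemma circuit_indexE h i : (h \in circuit_halves (circ i)) = (circuit_index h == i).
Proof.
have hk := xchooseP (circ_exists h); rewrite -/(circuit_index h) in hk.
apply/idP/eqP => [hi|<- //].
have up : uniq (flatten (map (@circuit_halves F) P)).
  by rewrite (perm_uniq (circuit_partitionP P)) enum_uniq.
have hki : h \in circuit_halves (nth (circ i) P (circuit_index h)) by rewrite -circ_nth.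
have hi' : h \in circuit_halves (nth (circ i) P i) by rewrite -circ_nth.
exact/val_inj/(uniq_flatten_nth up (ltn_ord _) (ltn_ord _) hki hi').
Qed.

Lemma circuit_index_halves h : h \in circuit_halves (circ (circuit_index h)).
Proof. by rewrite circuit_indexE. Qed.

Definition leaves h : bool := h \in (circ (circuit_index h) : seq _).

Lemma circuit_index_mate h : circuit_index (mate h) = circuit_index h.
Proof.
by apply/eqP; rewrite -circuit_indexE mem_halves mateK orbC -mem_halves circuit_index_halves.
Qed.

Lemma leaves_mate h : leaves (mate h) = ~~ leaves h.
Proof.
have := circuit_index_halves h; rewrite /leaves circuit_index_mate mem_halves.
case: (boolP (h \in _)) => [hc _|_ /= ->//].
by apply/negbTE/circuit_mate.
Qed.

Lemma mem_circ h i : (h \in (circ i : seq _)) = leaves h && (circuit_index h == i).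
Proof.
apply/idP/andP => [hi|[hl /eqP<- //]].
have /eqP e : circuit_index h == i by rewrite -circuit_indexE mem_halves hi.
by rewrite /leaves e hi.
Qed.

Lemma leavesE h : leaves h = has (fun c : circuit F => h \in (c : seq _)) P.
Proof.
apply/idP/hasP=> [hl|[c cP hc]]; first by exists (circ (circuit_index h)); rewrite ?mem_tnth.
have := cP; rewrite -index_mem => ilt.
have := mem_circ h (Ordinal ilt); rewrite (circ_nth c) /= nth_index // hc.
by case: (leaves h).
Qed.

(* The half-edge paired with h by the transition of P at its vertex. *)
Definition opp h : half_edge F :=
  let c := circ (circuit_index h) in
  if leaves h then mate (prev c h) else next c (mate h).

Lemma opp_mate h : leaves h -> opp (mate h) = next (circ (circuit_index h)) h.
Proof. by move=> hl; rewrite /opp leaves_mate hl circuit_index_mate mateK. Qed.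

Lemma next_leaves h : leaves h ->
  leaves (next (circ (circuit_index h)) h) /\ circuit_index (next (circ (circuit_index h)) h) =
    circuit_index h.
Proof.
move=> hl; have : next (circ (circuit_index h)) h \in (circ (circuit_index h) : seq _) by
  rewrite mem_next.
by rewrite mem_circ => /andP[-> /eqP].
Qed.

Lemma prev_leaves h : leaves h ->
  leaves (prev (circ (circuit_index h)) h) /\ circuit_index (prev (circ (circuit_index h)) h) =
    circuit_index h.
Proof.
move=> hl; have : prev (circ (circuit_index h)) h \in (circ (circuit_index h) : seq _) by
  rewrite mem_prev.
by rewrite mem_circ => /andP[-> /eqP].
Qed.

Lemma opp_leaves h : leaves (opp h) = ~~ leaves h.
Proof.
rewrite /opp; case: ifP => hl; first by rewrite leaves_mate (prev_leaves hl).1.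
have ml : leaves (mate h) by rewrite leaves_mate hl.
by have := next_leaves ml; rewrite circuit_index_mate => -[-> _].
Qed.

Lemma circuit_index_opp h : circuit_index (opp h) = circuit_index h.
Proof.
rewrite /opp; case: ifP => hl; first by rewrite circuit_index_mate (prev_leaves hl).2.
have ml : leaves (mate h) by rewrite leaves_mate hl.
by have := next_leaves ml; rewrite circuit_index_mate => -[_ ->].
Qed.

Lemma oppK : involutive opp.
Proof.
move=> h; have [hl|hl] := boolP (leaves h).
  have [pl pk] := prev_leaves hl.
  by rewrite {2}/opp hl opp_mate // pk next_prev // circuit_uniq.
have ml : leaves (mate h) by rewrite leaves_mate hl.
rewrite /opp circuit_index_opp opp_leaves hl /opp (negbTE hl) prev_next ?mateK //.
exact: circuit_uniq.
Qed.

Lemma opp_neq h : opp h != h.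
Proof. by apply/eqP=> e; have := opp_leaves h; rewrite e; case: (leaves h). Qed.

Lemma vtx_opp h : vtx (opp h) = vtx h.
Proof.
rewrite /opp; case: ifP => hl.
  have [pl _] := prev_leaves hl.
  rewrite -(@circuit_next _ (circ (circuit_index h))) ?mem_prev //.
  by rewrite next_prev // circuit_uniq.
have ml : leaves (mate h) by rewrite leaves_mate hl.
by rewrite circuit_next ?mateK // mem_circ ml circuit_index_mate eqxx.
Qed.

(** On a leaving half-edge the successor along the circuit is [opp (mate h)], so invariance under
    [mate] and [opp] propagates around the whole circuit. *)
Lemma circuit_index_connect (T : Type) (y : half_edge F -> T) h k :
  (forall h, y (mate h) = y h) -> (forall h, y (opp h) = y h) ->
  circuit_index h = circuit_index k -> y h = y k.
Proof.
move=> ym yo; wlog hl : h / leaves h.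
  move=> W hk; have [hl|hl] := boolP (leaves h); first exact: W.
  by rewrite -ym; apply: W; rewrite ?leaves_mate // circuit_index_mate.
wlog kl : k / leaves k.
  move=> W hk; have [kl|kl] := boolP (leaves k); first exact: W.
  by rewrite -(ym k); apply: W; rewrite ?leaves_mate // circuit_index_mate.
move=> hk; have yn z : leaves z -> y (next (circ (circuit_index z)) z) = y z.
  by move=> zl; rewrite -opp_mate // yo ym.
set c := circ (circuit_index h); have hc : h \in (c : seq _) by rewrite mem_circ hl eqxx.
have kc : k \in (c : seq _) by rewrite mem_circ kl hk eqxx.
have {yn} yn z : z \in (c : seq _) -> y (next c z) = y z.
  by rewrite mem_circ => /andP[/yn + /eqP e]; rewrite e.
have := fconnect_cycle (cycle_next (circuit_uniq c)) hc k; rewrite kc => /iter_findex <-.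
have yi n : iter n (next c) h \in (c : seq _) /\ y (iter n (next c) h) = y h.
  by elim: n => // n [nc yE] /=; rewrite mem_next yn.
by rewrite (yi _).2.
Qed.

Lemma circuit_passes i v : passes (circ i) v = [exists h, (vtx h == v) && (circuit_index h ==
  i)].
Proof.
apply/mapP/existsP => [[h hc ->]|[h /andP[/eqP<- hi]]].
  by exists h; rewrite eqxx -circuit_indexE mem_halves hc.
have [hl|hl] := boolP (leaves h); first by exists h; rewrite // mem_circ hl.
have ml : leaves (mate h) by rewrite leaves_mate hl.
exists (opp h); last by rewrite vtx_opp.
by rewrite mem_circ opp_leaves hl circuit_index_opp.
Qed.

Lemma passagesE v : passages P v = [set [set h; opp h] | h in star v].
Proof.
apply/setP=> A; rewrite inE; apply/hasP/imsetP.
  case=> c cP /existsP[h /and3P[hc hv /eqP->]].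
  have hl : leaves h by rewrite leavesE; apply/hasP; exists c.
  have cE : circ (circuit_index h) = c.
    have := cP; rewrite -index_mem => ilt.
    have := mem_circ h (Ordinal ilt); rewrite (circ_nth c) /= nth_index // hc hl /= =>
      /esym/eqP->.
    by rewrite (circ_nth c) /= nth_index.
  by exists (mate h); rewrite ?inE // opp_mate // cE.
case=> h; rewrite inE => hv ->; have [hl|hl] := boolP (leaves h).
  have ol : leaves (mate (opp h)) by rewrite leaves_mate opp_leaves hl.
  exists (circ (circuit_index (mate (opp h)))); first exact: mem_tnth.
  apply/existsP; exists (mate (opp h)); rewrite mem_circ ol mateK vtx_opp hv eqxx /=.
  by rewrite -opp_mate // mateK oppK setUC.
have ml : leaves (mate h) by rewrite leaves_mate hl.
exists (circ (circuit_index (mate h))); first exact: mem_tnth.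
apply/existsP; exists (mate h); rewrite mem_circ ml mateK hv eqxx /=.
by rewrite -opp_mate // mateK.
Qed.

Lemma passages_pairing h : passages P (vtx h) = pairing_with (vtx h) h (opp h).
Proof.
rewrite passagesE; have c2 := card_starD (erefl (vtx h)) (vtx_opp h) (opp_neq h).
have pair k : vtx k = vtx h -> [set k; opp k] = [set h; opp h] \/
    [set k; opp k] = star (vtx h) :\: [set h; opp h].
  move=> kv; have [->|kh] := eqVneq k h; first by left.
  have [->|ko] := eqVneq k (opp h); first by left; rewrite oppK setUC.
  right; apply/eqP; rewrite eqEcard c2 cards2 eq_sym opp_neq andbT.
  apply/subsetP=> z; rewrite !inE => /orP[]/eqP->.
    by rewrite kv eqxx (negbTE kh) (negbTE ko).
  rewrite vtx_opp kv eqxx (can2_eq oppK oppK) (negbTE ko) (inj_eq (inv_inj oppK)).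
  by rewrite (negbTE kh).
apply/setP=> A; rewrite !inE; apply/imsetP/orP.
  case=> k; rewrite inE => /eqP kv ->.
  by case: (pair k kv) => ->; rewrite eqxx; [left|right].
case=> /eqP->; first by exists h; rewrite ?inE.
have /card_gt0P[k] : (0 < #|star (vtx h) :\: [set h; opp h]|)%N by rewrite c2.
move=> kA; exists k; first by move: kA; rewrite inE => /andP[].
have kv : vtx k = vtx h by move: kA; rewrite !inE => /andP[_ /eqP].
case: (pair k kv) => // e; move: kA; rewrite -e !inE eqxx.
by [].
Qed.

Lemma passages_transition v : is_transition v (passages P v).
Proof.
rewrite -(vtx_ref v) passages_pairing; apply: pairing_with_transition => //.
  exact: vtx_opp.
exact: opp_neq.
Qed.

Definition tau_at v : transition F :=
  Sub (v, passages P v) (passages_transition v).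

Lemma tvertex_tau_at v : tvertex (tau_at v) = v.
Proof. by []. Qed.

Lemma partner_tau_at h : partner (tau_at (vtx h)) h = opp h.
Proof.
by apply: partner_eq (opp_neq h) _; rewrite /tpairs /= passages_pairing !inE eqxx.
Qed.

Lemma tauE t : (tpairs t == passages P (tvertex t)) = (t == tau_at (tvertex t)).
Proof.
apply/eqP/eqP => [e|{1}->//]; apply: val_inj.
by rewrite [LHS]surjective_pairing -/(tvertex t) -/(tpairs t) e.
Qed.

Lemma partner_tau_eq t h : vtx h = tvertex t -> (partner t h == opp h) = (t == tau_at (tvertex
  t)).
Proof.
move=> hv; apply/eqP/eqP => [e|->]; last by rewrite /= -hv partner_tau_at.
by apply: (partner_inj hv); rewrite // e -hv partner_tau_at.
Qed.

Lemma mem_tau t : (t \in tau P) = (t == tau_at (tvertex t)).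
Proof. by rewrite inE tauE. Qed.

Lemma star_opp h : exists k, uniq [:: h; opp h; k; opp k] /\
  forall z, (vtx z == vtx h) = (z \in [:: h; opp h; k; opp k]).
Proof.
have c2 := card_starD (erefl (vtx h)) (vtx_opp h) (opp_neq h).
have /card_gt0P[k] : (0 < #|star (vtx h) :\: [set h; opp h]|)%N by rewrite c2.
rewrite !inE negb_or => /andP[/andP[kh ko] /eqP kv]; exists k.
have u : uniq [:: h; opp h; k; opp k].
  rewrite /= !inE !negb_or ![h == _]eq_sym opp_neq kh (can2_eq oppK oppK) ko.
  rewrite [opp h == _]eq_sym ko (inj_eq (inv_inj oppK)) [h == k]eq_sym kh.
  by rewrite [k == _]eq_sym opp_neq.
split=> // z; have sE : [set x in [:: h; opp h; k; opp k]] = star (vtx h).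
  apply/eqP; rewrite eqEcard card_star (cardsE (mem [:: h; opp h; k; opp k])) (card_uniqP u)
    leqnn andbT.
  by apply/subsetP=> x; rewrite !inE => /or4P[]/eqP->; rewrite ?vtx_opp ?kv.
by have /setP/(_ z) := sE; rewrite !inE.
Qed.

Lemma sum_opp (K : zmodType) (f : half_edge F -> K) h k : uniq [:: h; opp h; k; opp k] ->
  vtx k = vtx h -> \sum_(z | vtx z == vtx h) f z = f h + f (opp h) + f k + f (opp k).
Proof. by move=> u kv; apply: sum_star4 u _; rewrite /= !vtx_opp kv !eqxx. Qed.

Lemma touch_graph_ends h k :
  (forall z, (vtx z == vtx h) = (z \in [:: h; opp h; k; opp k])) ->
  mg_ends (m := touch_graph P) (vtx h) = [set circuit_index h; circuit_index k].
Proof.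
move=> sE; apply/setP=> i; rewrite !inE circuit_passes; apply/existsP/orP.
  case=> z; rewrite sE !inE => /andP[/or4P[]/eqP-> /eqP<-]; rewrite ?circuit_index_opp eqxx;
    first [by left|by right].
case=> /eqP->; [exists h|exists k]; rewrite ?eqxx // sE !inE eqxx ?orbT //.
Qed.

Lemma touch_graph_endsP v : exists i j : 'I_(size P),
  mg_ends (m := touch_graph P) v = [set i; j].
Proof.
have [k [_ sE]] := star_opp (ref v); exists (circuit_index (ref v)), (circuit_index k).
by rewrite -{1}[v]vtx_ref (touch_graph_ends sE).
Qed.

Definition tau_indic (D : {set vertex F}) : {ffun transition F -> 'F_2} :=
  [ffun t => ((t \in tau P) && (tvertex t \in D))%:R].

(** The vector has at most one nonzero entry at each vertex, at the transition of [P], which the sum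
    omits exactly when [t] is that transition. *)
Lemma sum_tau_indic D t :
  \sum_(t' | (tvertex t' == tvertex t) && (t' != t)) tau_indic D t' =
  ((tvertex t \in D) && (t != tau_at (tvertex t)))%:R.
Proof.
under eq_bigr => t' /andP[/eqP tv _] do rewrite ffunE mem_tau tv.
have [e|nt] := eqVneq t (tau_at (tvertex t)).
  by rewrite andbF big1 // => t' /andP[_]; rewrite {1}e => /negbTE->.
rewrite andbT (bigD1 (tau_at (tvertex t))) /=; last by rewrite tvertex_tau_at eqxx eq_sym.
by rewrite eqxx big1 ?addr0 // => t' /andP[_ /negbTE->].
Qed.

(* A function on half-edges constant along the circuits of P is a set of
   vertices of the touch-graph, and it is nonconstant at a vertex of F exactly
   when that vertex is an edge of the corresponding cut. *)
Lemma cycle_orthogonal_tau D : cycle_orthogonal (tau_indic D) <->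
  exists X, forall v, crosses (G := touch_graph P) X v = (v \in D).
Proof.
rewrite cycle_orthogonalP; split=> [[y cy yl]|[X cX]].
  (* The prescribed value at a transition of [P] is zero, so [y] agrees on the half-edges it pairs
     and is constant along circuits. *)
  have yo h : y (opp h) = y h.
    apply/esym/F2_eq; have tv : vtx h = tvertex (tau_at (vtx h)) by [].
    have := tr_valueE cy tv; rewrite partner_tau_at => <-.
    by rewrite yl sum_tau_indic tvertex_tau_at eqxx andbF.
  have yk h k : circuit_index h = circuit_index k -> y h = y k by apply: circuit_index_connect
    cy.1 yo.
  pose X := [set i | [exists h, (circuit_index h == i) && (y h == 1)]].
  have XE h : (circuit_index h \in X) = (y h == 1).
    rewrite inE; apply/existsP/idP => [[k /andP[/eqP/yk <-]]//|yh].
    by exists h; rewrite eqxx.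
  exists X => v; set h := ref v; have hv : vtx h = v by exact: vtx_ref.
  have [k [u sE]] := star_opp h; have ends := touch_graph_ends sE.
  rewrite hv in ends sE; rewrite (crossesE (G := touch_graph P) X ends) !XE.
  have kv : vtx k = v by apply/eqP; rewrite sE !inE eqxx !orbT.
  have kh : k != h by move: u; rewrite /= !inE !negb_or ![k == _]eq_sym => /and3P[/and3P[_ ->]].
  have ko : k != opp h by move: u; rewrite /= !inE !negb_or ![k == _]eq_sym => /and3P[_
    /andP[->]].
  (* A transition joining the two passages at [v] reads off [y h + y k], which tells whether the
     edge [v] crosses [X]. *)
  have [|t tv tp] := @partner_surj F h k _ kh; first by rewrite kv hv.
  have := yl t; rewrite (tr_valueE cy (esym tv)) tp sum_tau_indic tv hv.
  rewrite -hv -tv -(partner_tau_eq (esym tv)) tp ko andbT tv hv.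
  by case: (F2_cases (y h)) => ->; case: (F2_cases (y k)) => ->; case: (v \in D).
pose y h : 'F_2 := (circuit_index h \in X)%:R.
have yo h : y (opp h) = y h by rewrite /y circuit_index_opp.
have ym h : y (mate h) = y h by rewrite /y circuit_index_mate.
have cy : even_cycle y.
  split=> // v; rewrite -[v]vtx_ref; have [k [u sE]] := star_opp (ref v).
  rewrite (sum_opp _ u) ?yo; last by apply/eqP; rewrite sE !inE eqxx !orbT.
  by rewrite F2_addrr add0r F2_addrr.
exists y => // t; have rv := vtx_ref (tvertex t); rewrite sum_tau_indic (tr_valueE cy rv).
set h := ref _ in rv *; rewrite -(partner_tau_eq rv).
have [k [u sE]] := star_opp h; have ends := touch_graph_ends sE.
have := crossesE (G := touch_graph P) X ends; rewrite cX rv => ->.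
have [pv ph _] := partnerP rv; have := sE (partner t h); rewrite pv rv eqxx !inE (negbTE ph) /=.
case: eqP => [->|_] /=; first by rewrite andbF yo F2_addrr.
have yE : y h + y k = ((circuit_index h \in X) (+) (circuit_index k \in X))%:R.
  by rewrite /y; case: (_ \in X); case: (_ \in X); apply: val_inj.
by rewrite andbT => /esym/orP[]/eqP->; rewrite ?yo yE.
Qed.

End Partition.

(** * Euler systems and the transition matroid *)

Section Seq.
Local Open Scope nat_scope.
Variable T : eqType.
Implicit Types (s A B D : seq T).

Lemma count1_nth (a : pred T) x0 s i j : count a s = 1 -> i < size s -> j < size s ->
  a (nth x0 s i) -> a (nth x0 s j) -> i = j.
Proof.
elim: s i j => // y s IHs [|i] [|j] //= c1 ilt jlt ai aj.
- by have : has a s by [apply/hasP; exists (nth x0 s j); rewrite ?mem_nth]; move: c1; rewrite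
  ai has_count; lia.
- by have : has a s by [apply/hasP; exists (nth x0 s i); rewrite ?mem_nth]; move: c1; rewrite
  aj has_count; lia.
congr _.+1; apply: IHs => //; have : has a s by apply/hasP; exists (nth x0 s i); rewrite
  ?mem_nth.
by move: c1; rewrite has_count; lia.
Qed.

(** Going round the cycle, membership in the segment [h1 :: B] changes only on arrival at [h1] or
    [h2]. This is a comparison of indices, the successor of the last one being 0. *)
Lemma next_segment h1 h2 B D u : let p := h1 :: B ++ h2 :: D in
  uniq p -> u \in p ->
  (next p u \in h1 :: B) (+) (u \in h1 :: B) = (next p u == h1) || (next p u == h2).
Proof.
move=> p Up up; pose m := (size B).+1; pose n := index u p.
have segE z : z \in p -> (z \in h1 :: B) = (index z p < m).
  by move=> zp; rewrite -in_take //= take_size_cat.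
have mlt : m < size p by rewrite /= size_cat /=; lia.
have h2E : nth h1 p m = h2 by rewrite /= nth_cat ltnn subnn.
have nlt : n < size p by rewrite index_mem.
have np : next p u \in p by rewrite mem_next.
have eqE i : i < size p -> (next p u == nth h1 p i) = (index (next p u) p == i).
  move=> ilt; apply/eqP/eqP => [->|<-]; first by rewrite index_uniq.
  by rewrite nth_index.
rewrite !segE // -[X in _ || (_ == X)]h2E eqE // -[X in (_ == X) || _]/(nth h1 p 0) eqE //.
have -> : index (next p u) p = if n.+1 < size p then n.+1 else 0.
  have -> : next p u = nth h1 p n.+1 by rewrite next_nth up.
  case: ifP => nl; first by rewrite index_uniq.
  have nge : size p <= n.+1 by rewrite leqNgt nl.
  by rewrite (nth_default _ nge) [LHS]/= eqxx.
rewrite -/n; case: ifP => nl; lia.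
Qed.

Lemma filter_rot (a : pred T) i s :
  filter a (rot i s) = rot (count a (take i s)) (filter a s).
Proof.
have fs : filter a s = filter a (take i s) ++ filter a (drop i s).
  by rewrite -filter_cat cat_take_drop.
by rewrite /rot filter_cat -size_filter fs drop_size_cat // take_size_cat.
Qed.

Lemma filter_notin (w v : T) s : w \notin s ->
  filter (pred2 w v) s = nseq (count_mem v s) v.
Proof.
elim: s => //= x s IHs; rewrite inE negb_or eq_sym => /andP[/negbTE-> /IHs->] /=.
by case: eqP => [->|].
Qed.

(** Only the cyclic word of length four left by deleting the letters other than [w] and [v] matters.
    It alternates when exactly one [v] lies in [B], and as [v] occurs twice this means an odd
    number. *)
Lemma interlace_seq w v A B D : let u := A ++ w :: B ++ w :: D in
  w != v -> w \notin A ++ B ++ D -> count_mem v u = 2 ->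
  has (fun i => subseq [:: w; v; w; v] (rot i u)) (iota 0 (size u)) = odd (count_mem v B).
Proof.
move=> u wv; rewrite !mem_cat !negb_or => /and3P[wA wB wD] cu.
have [vw vw'] : (v == w) = false /\ (w == v) = false by rewrite eq_sym (negbTE wv).
pose a := count_mem v A; pose b := count_mem v B; pose d := count_mem v D.
have abd : a + b + d = 2 by move: cu; rewrite /u count_cat /= count_cat /= vw' -/a -/b -/d; lia.
have fE : filter (pred2 w v) u = nseq a v ++ w :: nseq b v ++ w :: nseq d v.
  by rewrite /u filter_cat /= eqxx filter_cat /= eqxx !filter_notin.
apply/hasP/idP => [[i _ si]|bodd].
  have {}si : subseq [:: w; v; w; v] (filter (pred2 w v) (rot i u)).
    by rewrite subseq_filter si andbT /= !eqxx !orbT.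
  move: si; rewrite filter_rot fE -/b; move: (count _ _) => j.
  have : [|| (b == 1), (b == 0) | (b == 2)] by lia.
  case/or3P=> /eqP bE; rewrite bE //; last first.
    have [-> ->] : a = 0 /\ d = 0 by lia.
    by case: j => [|[|[|[|j]]]]; rewrite /rot /= ?(vw, vw', eqxx) /= ?(vw, vw', eqxx).
  have : [|| (a == 0) && (d == 2), (a == 1) && (d == 1) | (a == 2) && (d == 0)] by lia.
  by case/or3P=> /andP[/eqP-> /eqP->]; case: j => [|[|[|[|j]]]];
    rewrite /rot /= ?(vw, vw', eqxx) /= ?(vw, vw', eqxx).
exists (size A); first by rewrite mem_iota /u size_cat /=; lia.
rewrite /u rot_size_cat; apply: (@subseq_trans _ (filter (pred2 w v) ((w :: B ++ w :: D) ++
  A))).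
  rewrite filter_cat /= eqxx filter_cat /= eqxx !filter_notin // -/a -/b -/d.
  have -> : b = 1 by lia.
  have : (a == 0) && (d == 1) || (a == 1) && (d == 0) by lia.
  by case/orP=> /andP[/eqP-> /eqP->]; rewrite /= ?(vw, vw', eqxx).
exact: filter_subseq.
Qed.

Lemma split_two s x y : x \in s -> y \in s -> x != y ->
  exists A B D, s = A ++ x :: B ++ y :: D \/ s = A ++ y :: B ++ x :: D.
Proof.
move=> /splitPr[p1 p2]; rewrite mem_cat inE => yp xy.
rewrite eq_sym (negbTE xy) /= in yp; case/orP: yp => [/splitPr[q1 q2]|/splitPr[q1 q2]].
  by exists q1, q2, p2; right; rewrite -catA.
by exists p1, q1, q2; left.
Qed.

End Seq.

Section Euler.
Variables (F : graph4) (C : euler_system F).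
Implicit Types (h k : half_edge F) (v w : vertex F) (t : transition F).
Local Notation circuit_index := (circuit_index C).
Local Notation opp := (opp C).
Local Notation leaves := (leaves C).
Local Notation circ := (@circ F C).
Local Notation tau_at := (tau_at C).

Lemma mem_circuit (c : circuit F) h : c \in (C : seq _) -> h \in (c : seq _) ->
  leaves h /\ circ (circuit_index h) = c.
Proof.
move=> cC hc; have hl : leaves h by rewrite leavesE; apply/hasP; exists c.
have := cC; rewrite -index_mem => ilt.
have := mem_circ h (Ordinal ilt); rewrite (circ_nth c) /= nth_index // hc hl => /esym/eqP->.
by rewrite (circ_nth c) /= nth_index.
Qed.

(** Circuits through a common vertex meet the same component, which an Euler system covers by a
    single circuit. *)
Lemma euler_circuit_index h k : vtx h = vtx k -> circuit_index h = circuit_index k.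
Proof.
move=> hk; have meets z : vtx z = vtx h ->
    has (fun z' => connect (@adjacent F) (vtx h) (vtx z')) (circ (circuit_index z)).
  move=> zh; have : passes (circ (circuit_index z)) (vtx h).
    by rewrite circuit_passes; apply/existsP; exists z; rewrite zh !eqxx.
  by case/mapP=> z' z'c ->; apply/hasP; exists z'.
have /forallP/(_ (vtx h))/eqP c1 := euler_systemP C.
apply/val_inj/(count1_nth (x0 := circ (circuit_index h)) c1 (ltn_ord _) (ltn_ord _)).
  by rewrite -circ_nth; apply: meets.
by rewrite -circ_nth; apply: meets.
Qed.

Lemma star_leaves v : exists h k, [/\ leaves h, leaves k, vtx h = v /\ vtx k = v,
  uniq [:: h; opp h; k; opp k] & forall z, (vtx z == v) = (z \in [:: h; opp h; k; opp k])].
Proof.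
have [h hl hv] : exists2 h, leaves h & vtx h = v.
  have [hl|hl] := boolP (leaves (ref v)); first by exists (ref v); rewrite ?vtx_ref.
  by exists (opp (ref v)); rewrite ?opp_leaves // vtx_opp vtx_ref.
have [k [u sE]] := star_opp C h; rewrite hv in sE.
have kv : vtx k = v by apply/eqP; rewrite sE !inE eqxx !orbT.
have [kl|kl] := boolP (leaves k); first by exists h, k.
have perm : perm_eq [:: h; opp h; k; opp k] [:: h; opp h; opp k; k].
  by rewrite !perm_cons -[[:: k; opp k]]/([:: k] ++ [:: opp k]) perm_catC.
exists h, (opp k); rewrite hl opp_leaves kl vtx_opp kv oppK; split=> //.
  by rewrite -(perm_uniq perm).
by move=> z; rewrite sE (perm_mem perm).
Qed.

Lemma leaves_at h k z : leaves h -> leaves k ->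
  (forall z, (vtx z == vtx h) = (z \in [:: h; opp h; k; opp k])) ->
  leaves z -> (vtx z == vtx h) = (z == h) || (z == k).
Proof.
move=> hl kl sE zl; rewrite sE !inE.
have no y : leaves y -> (z == opp y) = false.
  by move=> yl; apply: contraTF zl => /eqP->; rewrite opp_leaves yl.
by rewrite !no // orbF.
Qed.

(* The witness x is the set of edges of a circuit of C between its two visits to w. *)
Lemma segment w : exists x : half_edge F -> 'F_2, [/\ even_cycle x,
  forall h, x h + x (opp h) = (vtx h == w)%:R &
  forall h k, leaves h -> leaves k -> uniq [:: h; opp h; k; opp k] ->
    (forall z, (vtx z == vtx h) = (z \in [:: h; opp h; k; opp k])) ->
    x h + x k = ((vtx h == w) || interlaced C w (vtx h))%:R].
Proof.
have [h1 [h2 [l1 l2 [v1 v2] u12 sE]]] := star_leaves w.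
have kap : circuit_index h2 = circuit_index h1 by apply: euler_circuit_index; rewrite v1.
pose c := circ (circuit_index h1).
have h1c : h1 \in (c : seq _) by rewrite mem_circ l1 eqxx.
have h2c : h2 \in (c : seq _) by rewrite mem_circ l2 kap eqxx.
have h12 : h1 != h2 by move: u12; rewrite /= !inE !negb_or => /and3P[/and3P[_ ->]].
have wE z : leaves z -> (vtx z == w) = (z == h1) || (z == h2).
  by move=> zl; rewrite -v1; apply: leaves_at => // y; rewrite v1 sE.
(* [g1] and [g2] are the half-edges by which [c] leaves [w], in the order of the list; the segment
   consists of [g1 :: B]. *)
have {l1 l2 v1 v2 u12 sE kap h1c h2c h12 wE} [g1 [g2 [A [B [D [cE gE]]]]]] :
    exists g1 g2 A B D, (c : seq _) = A ++ g1 :: B ++ g2 :: D /\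
    forall z, leaves z -> (vtx z == w) = (z == g1) || (z == g2).
  have [A [B [D [e|e]]]] := split_two h1c h2c h12.
    by exists h1, h2, A, B, D.
  by exists h2, h1, A, B, D; split=> // z zl; rewrite wE // orbC.
have cC : c \in (C : seq _) by exact: mem_tnth.
have Uc := circuit_uniq c; have Urot : uniq (g1 :: B ++ g2 :: D ++ A).
  by move: Uc; rewrite cE -cat_cons uniq_catC -!cat_cons -catA.
have rotE : rot (size A) c = g1 :: B ++ g2 :: D ++ A.
  by rewrite cE rot_size_cat -!cat_cons -catA.
have segc z : z \in g1 :: B -> z \in (c : seq _).
  by rewrite cE mem_cat -cat_cons mem_cat => ->; rewrite orbT.
have g1c : g1 \in (c : seq _) by apply: segc; rewrite inE eqxx.
have g2c : g2 \in (c : seq _) by rewrite cE !(mem_cat, inE) eqxx !orbT.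
have g2s : g2 \notin g1 :: B.
  by move: Urot; rewrite -cat_cons cat_uniq => /and3P[_ /norP[]].
pose x z : 'F_2 := (z \in g1 :: B)%:R + (mate z \in g1 :: B)%:R.
have xm z : x (mate z) = x z by rewrite /x mateK addrC.
have xl z : leaves z -> x z = (z \in g1 :: B)%:R.
  move=> zl; have mz : (mate z \in g1 :: B) = false.
    by apply/negP=> /segc/(mem_circuit cC)[+ _]; rewrite leaves_mate zl.
  by rewrite /x mz addr0.
have xo z : x z + x (opp z) = (vtx z == w)%:R.
  wlog zl : z / leaves z.
    move=> W; have [zl|zl] := boolP (leaves z); first exact: W.
    by have := W (opp z); rewrite oppK vtx_opp addrC => -> //; rewrite opp_leaves zl.
  (* [u] precedes [z] on its circuit and lies on the edge of [opp z], so [x] jumps at [z] exactly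
     when the circuit enters or quits the segment there. *)
  pose u := mate (opp z).
  have ul : leaves u by rewrite leaves_mate opp_leaves zl.
  have zu : z = next (circ (circuit_index u)) u by rewrite -opp_mate // mateK oppK.
  have zk : circuit_index z = circuit_index u by rewrite zu (next_leaves ul).2.
  rewrite -[x (opp z)]xm !xl // gE //.
  have [uc|uc] := eqVneq (circuit_index u) (circuit_index h1).
    have uc' : u \in g1 :: B ++ g2 :: D ++ A by rewrite -rotE mem_rot mem_circ ul uc eqxx.
    have := next_segment Urot uc'; rewrite -rotE next_rot //.
    rewrite (_ : next c u = z); last by rewrite zu uc.
    by rewrite -/u => <-; case: (z \in _); case: (u \in _); apply: val_inj.
  have nc y : leaves y -> circuit_index y = circuit_index u -> y \notin (c : seq _).
    by move=> yl yk; rewrite mem_circ yl yk.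
  rewrite !(negbTE (contra (@segc _) (nc _ _ _))) ?addr0 //.
  have zc := nc z zl zk.
  have [zg1|_] := eqVneq z g1; first by rewrite zg1 g1c in zc.
  by have [zg2|_] := eqVneq z g2; first by rewrite zg2 g2c in zc.
exists x; split=> //.
  split=> // v; have [h [k [_ _ [hv kv] u _]]] := star_leaves v.
  by rewrite -hv (sum_opp _ u) ?kv // xo -addrA xo hv kv F2_addrr.
move=> h k hl kl u sE; set v := vtx h in sE *.
have kv : vtx k = v by apply/eqP; rewrite sE !inE eqxx !orbT.
have hk : h != k by move: u; rewrite /= !inE !negb_or => /and3P[/and3P[_ ->]].
rewrite !xl //; have [vw|vw] /= := eqVneq v w.
  have := gE h hl; have := gE k kl; rewrite kv -/v vw eqxx => /esym + /esym.
  case/orP=> /eqP kE /orP[]/eqP hE; move: hk; rewrite kE hE ?eqxx // => _;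
  by rewrite (negbTE g2s) inE eqxx ?add0r ?addr0.
have atv z : leaves z -> (vtx z == v) = (z == h) || (z == k).
  by move=> zl; exact: leaves_at hl kl sE zl.
have ng z : leaves z -> vtx z = v -> (z == g1) || (z == g2) = false.
  by move=> zl zv; rewrite -gE // zv (negbTE vw).
have hg := ng h hl erefl; have kg := ng k kl kv.
(* Only [c] passes through [w], so interlacement with [w] can be read on [c]. *)
have onlyc (c' : circuit F) i : c' \in (C : seq _) ->
    subseq [:: w; v; w; v] (map (@vtx F) (rot i c')) -> c' = c.
  move=> c'C /mem_subseq/(_ w); rewrite inE eqxx map_rot mem_rot => /(_ isT)/mapP[z zc' wz].
  have [zl zk] := mem_circuit c'C zc'.
  have := gE z zl; rewrite -wz eqxx -zk => /esym/orP[]/eqP->.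
    exact: (mem_circuit cC g1c).2.
  exact: (mem_circuit cC g2c).2.
have cnt s : uniq s -> {subset s <= (c : seq _)} ->
    count_mem v (map (@vtx F) s) = ((h \in s) + (k \in s))%N.
  move=> us sc; rewrite count_map (eq_in_count (a2 := predU (pred1 h) (pred1 k))).
    have := count_predUI (pred1 h) (pred1 k) s; rewrite !count_uniq_mem // => <-.
    rewrite [X in (_ + X)%N](_ : _ = 0)%N ?addn0 //; apply/eqP; rewrite -leqn0 leqNgt
      -has_count.
    by apply/hasPn=> z _ /=; case: eqP => // ->.
  by move=> z /sc/(mem_circuit cC)[zl _]; rewrite /= atv.
have [hc|hc] := eqVneq (circuit_index h) (circuit_index h1); last first.
  have nc y : leaves y -> vtx y = v -> y \notin (c : seq _).
    by move=> yl yv; rewrite mem_circ yl (@euler_circuit_index y h).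
  rewrite !(negbTE (contra (@segc _) (nc _ _ _))) ?addr0 //.
  rewrite (_ : interlaced _ _ _ = false) //; apply/negP=> /andP[_ /hasP[c' c'C /hasP[i _ si]]].
  have e := onlyc _ _ c'C si; rewrite {c' c'C}e in si.
  have := mem_subseq si (_ : v \in _); rewrite !inE eqxx orbT => /(_ isT).
  rewrite map_rot mem_rot => /mapP[z zc vz]; have [zl _] := mem_circuit cC zc.
  by have := nc z zl (esym vz); rewrite zc.
have hkc : h \in (c : seq _) /\ k \in (c : seq _).
  by rewrite !mem_circ hl kl hc (@euler_circuit_index k h) // hc eqxx.
have -> : interlaced C w v = odd (count_mem v (map (@vtx F) B)).
  have mE : map (@vtx F) c = map (@vtx F) A ++ w :: map (@vtx F) B ++ w :: map (@vtx F) D.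
    rewrite cE !(map_cat, map_cons).
    have /eqP-> : vtx g1 == w by rewrite gE ?eqxx // (mem_circuit cC g1c).1.
    by have /eqP-> : vtx g2 == w by rewrite gE ?eqxx ?orbT // (mem_circuit cC g2c).1.
  rewrite -(@interlace_seq _ w v (map (@vtx F) A) _ (map (@vtx F) D)) -?mE 1?eq_sym //.
  - rewrite /interlaced eq_sym vw /= size_map; apply/hasP/hasP => [[c' c'C /hasP[i ii si]]|[i
    ii si]].
      have e := onlyc _ _ c'C si; rewrite {c' c'C}e in ii si.
      by exists i; rewrite // -map_rot.
    by exists c => //; apply/hasP; exists i; rewrite // map_rot.
  - rewrite -!map_cat; apply/mapP=> -[z zABD wz].
    have zc : z \in (c : seq _).
      by rewrite cE; move: zABD; rewrite !(mem_cat, inE) => /or3P[]->; rewrite ?orbT.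
    have [zl _] := mem_circuit cC zc; have := gE z zl; rewrite -wz eqxx => /esym.
    have := Urot; rewrite /= cat_uniq /= => /andP[n1 /and3P[_ /norP[n2 _] /andP[n3 _]]].
    move: n1 n2 n3 zABD; rewrite !(mem_cat, inE) !negb_or.
    move=> /and4P[a1 _ a2 a3] a4 /andP[a5 a6] zz /orP[]/eqP e; move: zz; rewrite e.
      by rewrite (negbTE a1) (negbTE a2) (negbTE a3).
    by rewrite (negbTE a4) (negbTE a5) (negbTE a6).
  by rewrite cnt // hkc.1 hkc.2.
have UB : uniq B by move: Urot; rewrite /= cat_uniq => /and3P[_ ->].
rewrite cnt //; last by move=> z zB; apply: segc; rewrite inE zB orbT.
move/norP: (negbT hg) => [/negbTE hg1 _]; move/norP: (negbT kg) => [/negbTE kg1 _].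
by rewrite !inE hg1 kg1 /=; case: (h \in B); case: (k \in B); apply: val_inj.
Qed.

(** With [h], [k] leaving and their opposites entering, phi pairs [h] with [opp h], chi pairs it
    with [opp k], and psi with [k]. *)
Lemma is_chiE t h k : leaves h -> leaves k -> uniq [:: h; opp h; k; opp k] ->
  (forall z, (vtx z == tvertex t) = (z \in [:: h; opp h; k; opp k])) ->
  is_chi C t = (partner t h == opp k).
Proof.
move=> hl kl u sE.
have hv : vtx h = tvertex t by apply/eqP; rewrite sE inE eqxx.
have kv : vtx k = tvertex t by apply/eqP; rewrite sE !inE eqxx !orbT.
have [pv ph tE] := partnerP hv.
rewrite /is_chi /is_phi tauE -(partner_tau_eq C hv).
have lE z : leaving C z = leaves z by rewrite leavesE.
have eE z : entering C z = ~~ leaves z by rewrite /entering lE leaves_mate.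
have okh : opp k != opp h by apply/eqP=> e; move: u; rewrite e /= !inE eqxx !orbT /= ?andbF.
have okh' : opp k != h by apply/eqP=> e; move: u; rewrite e /= !inE eqxx !orbT /= ?andbF.
apply/andP/eqP => [[po /forall_inP chi]|pk].
  have : [set h; partner t h] \in tpairs t by rewrite tE !inE eqxx.
  move=> /chi/existsP[a /existsP[b /and3P[ea lb /eqP ab]]].
  have : partner t h != k.
    apply/eqP=> pk; have : a \in [set h; partner t h] by rewrite ab !inE eqxx.
    by rewrite pk !inE => /orP[]/eqP e; move: ea; rewrite e eE ?hl ?kl.
  move: pv => /eqP; rewrite sE !inE (negbTE ph) (negbTE po) /=.
  by move=> /orP[/eqP->|/eqP->//]; rewrite eqxx.
rewrite pk okh; split=> //; apply/forall_inP=> B; rewrite tE pk !inE => /orP[]/eqP->.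
  apply/existsP; exists (opp k); apply/existsP; exists h.
  by rewrite eE lE opp_leaves kl hl setUC eqxx.
apply/existsP; exists (opp h); apply/existsP; exists k.
rewrite eE lE opp_leaves hl kl /=; apply/eqP/setP=> z; rewrite !inE sE !inE.
have [->|] := eqVneq z h.
  move: u; rewrite /= !inE !negb_or => /andP[/and3P[h1 h2 _] _].
  by rewrite (negbTE h1) (negbTE h2).
have [->|] //= := eqVneq z (opp k); last by rewrite orbF.
move: u; rewrite /= !inE !negb_or => /and4P[_ /andP[_ h1] h2 _].
by rewrite [opp k == opp h]eq_sym [opp k == k]eq_sym (negbTE h1) (negbTE h2).
Qed.

(** The cycle is that of [segment]. Its values at phi and psi are the two formulas given there, and
    its value at chi is their sum, which is the entry of [interlace_mx]. *)
Lemma IAS_row w : exists x : half_edge F -> 'F_2, [/\ even_cycle x,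
  forall h, x h + x (opp h) = (vtx h == w)%:R &
  forall t, IAS_mx C (enum_rank w) (transition_col C t) = tr_value t x].
Proof.
have [x [cx xo xint]] := segment w; exists x; split=> // t.
have [h [k [hl kl [hv kv] u sE]]] := star_leaves (tvertex t).
have [pv ph _] := partnerP hv.
rewrite (tr_valueE cx hv) /transition_col (is_chiE hl kl u sE).
have -> : is_phi C t = (partner t h == opp h) by rewrite /is_phi tauE -(partner_tau_eq C hv).
rewrite /IAS_mx; set v := tvertex t in hv kv sE pv *.
have xhk : x h + x k = ((v == w) || interlaced C w v)%:R.
  by rewrite xint // hv.
have wv : (enum_rank w == enum_rank v) = (v == w).
  by rewrite (inj_eq enum_rank_inj) eq_sym.
have iwv : v == w -> interlaced C w v = false by move=> /eqP->; rewrite /interlaced eqxx.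
have [po|po] := eqVneq (partner t h) (opp h).
  by rewrite row_mxEl mxE po xo hv wv.
have [pk|pk] := eqVneq (partner t h) (opp k).
  rewrite row_mxEr row_mxEl mxE !enum_rankK pk.
  have <- : x k + (v == w)%:R = x (opp k).
    by rewrite -kv -(xo k) addrA F2_addrr add0r.
  rewrite addrA xhk; move: iwv; case: (v == w) => [->//|_] /=; last by rewrite addr0.
  by rewrite F2_addrr.
have -> : partner t h = k.
  by apply/eqP; move/eqP: pv; rewrite sE !inE (negbTE ph) (negbTE po) (negbTE pk) /= orbF.
rewrite row_mxEr row_mxEr !mxE !enum_rankK xhk wv.
by move: iwv; case: (v == w) => [->|_] //=; rewrite ?addr0 ?add0r.
Qed.

Lemma tr_value_constant t (y : half_edge F -> 'F_2) : even_cycle y ->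
  (forall h, y (opp h) = y h) -> tr_value t y = 0.
Proof.
move=> cy yo; have rv := vtx_ref (tvertex t); have [pv _ _] := partnerP rv.
rewrite (tr_valueE cy rv) (circuit_index_connect cy.1 yo (euler_circuit_index (etrans rv (esym
  pv)))).
exact: F2_addrr.
Qed.

(** The rows are segment cycles, and every cycle is a sum of these up to a cycle constant along
    circuits, whose transition values vanish by [tr_value_constant]. The right-hand side does not
    mention [C]. *)
Lemma dependency_orthogonal (d : {ffun transition F -> 'F_2}) :
  dependency (IAS_mx C) (transition_col C) d <-> cycle_orthogonal d.
Proof.
have [X XP] := fin_all_exists IAS_row.
have XA w t : IAS_mx C (enum_rank w) (transition_col C t) = tr_value t (X w).
  by have [_ _ ->] := XP w.
split=> [/dependencyP Zd x cx|Zd]; last first.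
  apply/dependencyP=> i; rewrite -[i]enum_valK; set w := enum_val i.
  under eq_bigr do rewrite XA.
  by apply: Zd; have [] := XP w.
have ZX w : \sum_t d t * tr_value t (X w) = 0.
  by rewrite -[RHS](Zd (enum_rank w)); apply: eq_bigr => t _; rewrite XA.
(* [a w] is the jump of [x] along the passages of [C] at [w]. The segment cycle of [w] has jump one
   there and none elsewhere, so adding those with coefficients [a] makes [x] invariant under
   [opp]. *)
pose a w := x (ref w) + x (opp (ref w)).
have aE h : x h + x (opp h) = a (vtx h).
  have hv : vtx h = tvertex (tau_at (vtx h)) by [].
  rewrite -partner_tau_at -(tr_valueE cx hv) /a.
  have rv : vtx (ref (vtx h)) = tvertex (tau_at (vtx h)) by rewrite vtx_ref.
  by rewrite (tr_valueE cx rv) -(partner_tau_at C (ref _)) vtx_ref.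
pose x' h := x h + \sum_w a w * X w h.
have cx' : even_cycle x'.
  split=> [h|v].
    rewrite /x' cx.1; congr (_ + _); apply: eq_bigr => w _.
    by have [[-> _] _ _] := XP w.
  rewrite big_split /= cx.2 add0r exchange_big big1 // => w _.
  by rewrite -mulr_sumr; have [[_ ->] _ _] := XP w; rewrite mulr0.
have xo' h : x' (opp h) = x' h.
  apply/esym/F2_eq; rewrite /x' addrACA aE -big_split /=.
  rewrite (eq_bigr (fun w => a w * (vtx h == w)%:R)) => [|w _].
    rewrite (bigD1 (vtx h)) //= eqxx mulr1 big1 ?addr0 ?F2_addrr // => w.
    by rewrite eq_sym => /negbTE->; rewrite mulr0.
  by rewrite -mulrDr; have [_ -> _] := XP w.
have lamx t : tr_value t x = \sum_w a w * tr_value t (X w).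
  apply: F2_eq; rewrite -[RHS](tr_value_constant t cx' xo') {1 3}/tr_value /x' addrACA; congr
    (_ + _).
  by rewrite -big_split; apply: eq_bigr => w _; rewrite /tr_value mulrDr.
under eq_bigr do rewrite lamx mulr_sumr.
rewrite exchange_big /= big1 // => w _.
rewrite (eq_bigr (fun t => a w * (d t * tr_value t (X w)))) => [|t _]; last exact: mulrCA.
by rewrite -mulr_sumr ZX mulr0.
Qed.

End Euler.

(** * Vertex triples and the theorem *)

Section TripleStructure.
Variables (F : graph4) (Z : {ffun transition F -> 'F_2} -> bool).
Hypothesis ZE : forall d, Z d <-> cycle_orthogonal d.
Implicit Type t : transition F.

Lemma card_fibre_tvertex t : #|fibre (@tvertex F) t| = 3%N.
Proof.
have rv := vtx_ref (tvertex t).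
rewrite -(card_in_imset (f := fun t' => partner t' (ref (tvertex t)))); last first.
  by move=> t1 t2; rewrite !inE => /eqP e1 /eqP e2; apply: partner_inj; rewrite rv ?e1 ?e2.
have : #|star (tvertex t) :\ ref (tvertex t)| = 3%N.
  by have := cardsD1 (ref (tvertex t)) (star (tvertex t)); rewrite card_star inE rv eqxx => -[].
move=> <-; congr #|pred_of_set _|; apply/setP=> h; rewrite !inE; apply/imsetP/andP.
  case=> t'; rewrite inE => /eqP tv ->.
  have rv' : vtx (ref (tvertex t)) = tvertex t' by rewrite rv.
  by have [-> -> _] := partnerP rv'; rewrite tv.
case=> hr /eqP hv; have [|t' tv tp] := @partner_surj F (ref (tvertex t)) h _ hr.
  by rewrite rv.
by exists t'; rewrite ?inE ?tv ?rv.
Qed.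

(** The indicator of a triple corresponds to the zero cycle, each transition seeing two others at
    its vertex. For isotropy, the cycle corresponding to [d2] is orthogonal to [d1]. *)
Lemma transition_triples : triples Z (@tvertex F).
Proof.
split=> [|t|d1 d2 /ZE Z1 /ZE/cycle_orthogonalP[y cy yl]]; first exact: card_fibre_tvertex.
  apply/ZE/cycle_orthogonalP; exists (fun=> 0).
    by split=> // v; rewrite big1.
  move=> t'; rewrite /tr_value addr0; have [e|ne] := eqVneq (tvertex t') (tvertex t).
    have := cardsD1 t' (fibre (@tvertex F) t'); rewrite card_fibre_tvertex inE eqxx => -[c2].
    rewrite (eq_bigr (fun=> 1)) => [|t2 /andP[/eqP e2 _]]; last by rewrite ffunE inE e2 e eqxx.
    rewrite sumr_const (_ : #|_| = 2%N); first exact: val_inj.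
    by rewrite [RHS]c2; apply: eq_card => z; rewrite !inE andbC.
  by rewrite big1 // => t2 /andP[/eqP e2 _]; rewrite ffunE inE e2 (negbTE ne).
rewrite -[RHS](Z1 y cy); apply: eq_bigr => t _.
by rewrite yl mulr_sumr.
Qed.

End TripleStructure.

Lemma dependency0 (K : fieldType) (E : finType) (m n : nat) (A : 'M[K]_(m, n))
  (c : E -> 'I_n) : dependency A c 0.
Proof. by apply/dependencyP=> i; rewrite big1 // => e _; rewrite ffunE mul0r. Qed.

(** The vertex triples of [F'] pulled back along [f] are aligned with those of [F] by an
    automorphism [s]; the new isomorphism is [f \o s]. *)
Lemma compatible_iso (F F' : graph4) (C : euler_system F) (C' : euler_system F')
    (f : transition F -> transition F') :
  matroid_iso (transition_matroid C) (transition_matroid C') f ->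
  exists2 f1 : transition F -> transition F',
    matroid_iso (transition_matroid C) (transition_matroid C') f1 &
    forall t t', (tvertex (f1 t) == tvertex (f1 t')) = (tvertex t == tvertex t').
Proof.
move=> f_iso; have bf := f_iso.1.
pose Z := dependency (IAS_mx C) (transition_col C).
pose Z' := dependency (IAS_mx C') (transition_col C').
have Zf (d : {ffun transition F' -> 'F_2}) : Z [ffun e => d (f e)] = Z' d.
  exact: iso_dependency f_iso d.
have tp : triples Z (@tvertex F) by apply: transition_triples; exact: dependency_orthogonal.
have tp' : triples Z' (@tvertex F') by apply: transition_triples; exact: dependency_orthogonal.
have [s Zs sP] := triples_align (@dependencyD _ _ _ _ _ _) (dependency0 _ _)
  tp (triples_pull bf Zf tp').
exists (f \o s) => //; apply: dependency_iso.
  by apply: bij_comp => //; apply: injF_bij; exact: perm_inj.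
move=> d; rewrite -/Z -/Z' -Zf; apply: etrans (Zs _); congr (Z _).
by apply/ffunP=> t; rewrite !ffunE.
Qed.

Theorem theorem27 (F F' : graph4) (C : euler_system F) (C' : euler_system F') :
  (exists f : transition F -> transition F',
     matroid_iso (transition_matroid C) (transition_matroid C') f) ->
  exists f : transition F -> transition F',
    matroid_iso (transition_matroid C) (transition_matroid C') f /\
    exists g : vertex F -> vertex F',
      bijective g /\
      (forall v : vertex F, f @: transitions_at v = transitions_at (g v)) /\
      (forall (P : circuit_partition F) (P' : circuit_partition F'),
         tau P' = f @: tau P ->
         matroid_iso (cycle_matroid (G := touch_graph P))
                     (cycle_matroid (G := touch_graph P')) g).
Proof.
case=> f0 /compatible_iso[f f_iso fP]; exists f; split=> //.
have [f' fK f'K] := f_iso.1; have f_inj := can_inj fK.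
(* Any transition at [v] gives the same vertex by [fP]; that of [C] is merely a canonical choice. *)
pose g v := tvertex (f (tau_at C v)).
have gE t : tvertex (f t) = g (tvertex t) by apply/eqP; rewrite fP.
have g_bij : bijective g.
  exists (fun v' => tvertex (f' (tau_at C' v'))) => v.
    by apply/eqP; rewrite -[v in _ == v](tvertex_tau_at C) -fP f'K.
  by rewrite -gE f'K.
have g_inj := bij_inj g_bij.
exists g; split=> //; split=> [v|P P' tauP].
  apply/setP=> t; rewrite -[t]f'K mem_imset // !inE gE.
  by rewrite (inj_eq g_inj).
(* Cuts of the touch-graphs are the dependencies carried by the transitions of the partitions, and
   pulling [tau_indic] of [g @: D] back along [f] gives [tau_indic] of [D]. *)
have cutE (D : {set vertex F}) :
    (exists X, forall v, crosses (G := touch_graph P) X v = (v \in D)) <->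
    (exists X, forall v, crosses (G := touch_graph P') X v = (v \in g @: D)).
  rewrite -!cycle_orthogonal_tau -(dependency_orthogonal C) -(dependency_orthogonal C')
    -(iso_dependency f_iso).
  rewrite (_ : finfun _ = tau_indic P D) //; apply/ffunP=> t.
  by rewrite !ffunE tauP mem_imset // gE mem_imset.
have ends := touch_graph_endsP P; have ends' := touch_graph_endsP P'.
split=> // S; rewrite (cycle_matroidP (G := touch_graph P) ends) (cycle_matroidP (G :=
  touch_graph P') ends').
split=> cut e eS.
  case/imsetP: eS => v vS ->; have [X XP] := cut v vS.
  (* The full edge set of the cut isolating [v] is transported, not only its trace on [S]. *)
  have [|X' XP'] := (cutE [set v | crosses (G := touch_graph P) X v]).1.
    by exists X => w; rewrite inE.
  exists X' => e' /imsetP[w wS ->]; rewrite XP' mem_imset // inE XP //.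
  by rewrite (inj_eq g_inj).
have [|X XP] := cut (g e); first exact: imset_f.
have [|X' XP'] := (cutE [set v | crosses (G := touch_graph P') X (g v)]).2.
  exists X => w; have [g' _ g'K] := g_bij.
  by rewrite -[w]g'K mem_imset // inE.
exists X' => v vS; rewrite XP' inE XP ?imset_f //.
by rewrite (inj_eq g_inj).
Qed.
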